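(* There exists a computable bi-orderable group $G$ which does not have a presentation with computable bi-order; that is, no bi-order on $G$ is computable with respect to any countable enumerated generating set of $G$. Moreover, $G$ can be chosen to be a two-generated solvable group of derived length $3$.
   Context: For a group $G$ with a countable enumerated generating set $X=\{x_1,x_2,\ldots\}$ (finite or infinite), $(X\cup X^{-1})^*$ is the set of finite words in the formal letters $x_i^{\pm1}$; each word represents an element of $G$, and recursiveness of sets of words is understood via the indices of the letters. $G=\langle X\rangle$ is computable with respect to $X$ if $\{u\in (X\cup X^{-1})^*\mid u=_G1\}$ is recursive; a countable group is computable if it is computable with respect to some such generating set. A bi-order on $G$ is a linear order invariant under left and right multiplication; $G$ is bi-orderable if it has one. A linear order $\preceq$ on $G=\langle X\rangle$ is computable with respect to $X$ if $\{(u,v)\in (X\cup X^{-1})^*\times (X\cup X^{-1})^*\mid u\preceq v\}$ is recursive (words identified with the elements they represent). *)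

(* Defs.v *)
From HB Require Import structures.
From mathcomp Require Import all_boot.
Set Implicit Arguments.
Unset Strict Implicit.
Unset Printing Implicit Defensive.
Local Open Scope group_scope.

(* Kleene's schemes for the partial recursive functions.  Codes carry no arity:
   a code is run on a list of arguments, missing arguments being read as 0.
   On lists of any fixed length k, the partial functions obtained are exactly
   the partial recursive functions of k variables. *)
Inductive mucode : Type :=
| MuZero
| MuSucc
| MuProj of nat
| MuComp of mucode & seq mucode
| MuRec of mucode & mucode
| MuMin of mucode.

(* [computes c v y]: the computation of [c] on [v] halts with value [y].
   In [MuRec] the recursion variable is the first argument and [s] is the
   sequence of successive values; in [MuMin] all the values searched before
   [y] have to be defined. *)
Fixpoint computes (c : mucode) (v : seq nat) (y : nat) {struct c} : Prop :=
  match c with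
  | MuZero => y = 0
  | MuSucc => y = (head 0 v).+1
  | MuProj i => y = nth 0 v i
  | MuComp f gs =>
      exists2 ys : seq nat,
        (fix computes_all (gs : seq mucode) (ys : seq nat) : Prop :=
           match gs, ys with
           | [::], [::] => True
           | g :: gs', z :: ys' => computes g v z /\ computes_all gs' ys'
           | _, _ => False
           end) gs ys
        & computes f ys y
  | MuRec f g =>
      exists s : nat -> nat,
        [/\ computes f (behead v) (s 0),
            forall i, i < head 0 v ->
              computes g [:: i, s i & behead v] (s i.+1)
          & y = s (head 0 v)]
  | MuMin f =>
      computes f (y :: v) 0 /\
      forall m, m < y -> exists k, computes f (m :: v) k.+1
  end.

(* The formal letter x_i is [(i, false)] and x_i^-1 is [(i, true)]. *)
Definition letter : Type := (nat * bool)%type.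
Definition word : Type := seq letter.

(* A bijection from words onto nat: [CodeSeq.code] is one from [seq nat]. *)
Definition word_code (w : word) : nat :=
  CodeSeq.code [seq (a.1.*2 + a.2)%N | a : letter <- w].

Definition recursive_words (L : word -> Prop) : Prop :=
  exists c : mucode, forall w : word,
    (L w -> computes c [:: word_code w] 1) /\
    (~ L w -> computes c [:: word_code w] 0).

Definition recursive_word_pairs (L : word -> word -> Prop) : Prop :=
  exists c : mucode, forall u v : word,
    (L u v -> computes c [:: word_code u; word_code v] 1) /\
    (~ L u v -> computes c [:: word_code u; word_code v] 0).

Section GroupNotions.
Variable G : groupType.

Inductive generated (S : G -> Prop) : G -> Prop :=
| generated_mem g : S g -> generated S g
| generated_one : generated S 1
| generated_mul g h : generated S g -> generated S h -> generated S (g * h)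
| generated_inv g : generated S g -> generated S g^-1.

Definition two_generated : Prop :=
  exists a b : G, forall g, generated (fun h => h = a \/ h = b) g.

Fixpoint derived_subgroup (n : nat) : G -> Prop :=
  if n is m.+1 then
    generated (fun h => exists a b,
      [/\ derived_subgroup m a, derived_subgroup m b & h = [~ a, b]])
  else fun=> True.

Definition solvable_of_derived_length (n : nat) : Prop :=
  (forall g, derived_subgroup n g -> g = 1) /\
  (forall m, m < n -> ~ (forall g, derived_subgroup m g -> g = 1)).

(* A countable enumerated set X is given by [N] and [x : nat -> G]:
   X = {x_i | i < n} if [N = Some n], and X = {x_i | i in nat} if [N = None];
   the values of [x] outside of the index range are irrelevant. *)
Definition in_range (N : option nat) (i : nat) : bool :=
  if N is Some n then i < n else true.

Definition generating (N : option nat) (x : nat -> G) : Prop :=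
  forall g, generated (fun h => exists2 i, in_range N i & h = x i) g.

Definition is_word (N : option nat) (w : word) : bool :=
  all (fun a : letter => in_range N a.1) w.

Definition word_value (x : nat -> G) (w : word) : G :=
  \prod_(a <- w) (if a.2 then (x a.1)^-1 else x a.1).

Definition computable_wrt (N : option nat) (x : nat -> G) : Prop :=
  recursive_words (fun u => is_word N u /\ word_value x u = 1).

Definition computable_group : Prop :=
  exists (N : option nat) (x : nat -> G), generating N x /\ computable_wrt N x.

Record bi_order (le : G -> G -> Prop) : Prop := BiOrder {
  bi_order_refl : forall g, le g g;
  bi_order_anti : forall g h, le g h -> le h g -> g = h;
  bi_order_trans : forall g h k, le g h -> le h k -> le g k;
  bi_order_total : forall g h, le g h \/ le h g;
  bi_order_mull : forall k g h, le g h -> le (k * g) (k * h);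
  bi_order_mulr : forall k g h, le g h -> le (g * k) (h * k)
}.

Definition bi_orderable : Prop := exists le, bi_order le.

Definition computable_order_wrt (N : option nat) (x : nat -> G)
    (le : G -> G -> Prop) : Prop :=
  recursive_word_pairs (fun u v =>
    [/\ is_word N u, is_word N v & le (word_value x u) (word_value x v)]).

End GroupNotions.

(* Main.v *)
Require Import Defs.
From HB Require Import structures.
From mathcomp Require Import all_boot all_order all_algebra.
From mathcomp Require Import boolp zify ring.

Set Implicit Arguments.
Unset Strict Implicit.
Unset Printing Implicit Defensive.

(** The group is a central extension of the wreath product Z wr Z.  Start from
    the group generated by t and x in which x_i = t^i x t^-i, every commutator
    of x_i and x_j (i < j) is central and depends only on j - i; write z_m for
    the commutator of x_0 and x_m.  The z_m freely generate a central subgroup,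
    so any relations may be imposed on them.  With a_n = z_(2n+1) and
    c_n = z_(2n+2), the relations imposed are a_n = slope n * c_n for the n such
    that slope n is not 0, where slope : nat -> int is at first arbitrary.

    For every slope, this group G is generated by t and x, is bi-orderable and
    is solvable of derived length 3.  An element is a triple (h, f, k): k is the
    exponent of t, f the finitely supported function Z -> Z giving the exponents
    of the x_i, and h the central part, a function nat -> int.  It is positive
    when k > 0, or when k = 0 and the first nonzero value of f is positive, or
    when k = 0, f = 0 and the first nonzero value of h is positive
    ([elt_bi_orderable]).  The first derived subgroup lies in k = 0, the second
    one in k = 0, f = 0, which is central, so the third one is trivial; the
    second one is not, as it contains z_1^2 z_2^-1 ([elt_derived_length]).

    A bi-order on G decides, for each n, whether a_n and c_n have the same sign,
    and a nonzero slope n imposes the answer.  The slope is a diagonalization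
    ([diag_slope]): if some number certifies that the program with code n halts
    on n with the value 0 or 1, and s is the least one, then slope n = s + 1
    when the value is 0, which makes the signs equal, and slope n = - (s + 1)
    when the value is 1, which makes them opposite; otherwise slope n = 0.
    From an order computable with respect to some generating family one gets a program
    computing the truth value of: a_n and c_n have the same sign ([rec_sign]).
    At its own code this program is wrong ([no_computable_order]).

    Still the word problem is decidable ([elt_computable]), although the slope
    is not a computable function.  The central part of a word is known as a
    combination of the z_m, and the question is whether p a_n + q c_n vanishes.
    If p and q are not both 0, this happens only if q = - p * slope n with
    p nonzero, so that |slope n| <= |q|: it is enough to examine the
    certificates s < |q| ([pair_okP]).

    The certificates come from a version of the T predicate of Kleene: a list of
    evaluation facts in which each fact follows by one rule from two facts of
    the list ([certifies_complete], [certifies_sound]). *)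

(** * Closure properties of the computable functions *)

(** The number k of arguments has to be fixed: [MuComp] passes on finitely many
    values only, so that a recursion whose parameters are a list of arbitrary
    length could not be programmed. *)
Definition recursive (k : nat) (F : seq nat -> nat) : Prop :=
  exists c, forall v, size v = k -> computes c v (F v).

Lemma computes_Comp f gs v y :
  computes (MuComp f gs) v y <->
  exists2 ys, size ys = size gs /\
     (forall i, i < size gs -> computes (nth MuZero gs i) v (nth 0 ys i))
   & computes f ys y.
Proof.
split=> /=.
- case=> ys Hys Hy; exists ys => //.
  elim: gs ys Hys {Hy} => [|g gs IH] [|z ys] //= [Hz /IH [-> H]].
  by split=> // -[|i] //; apply: H.
- case=> ys [Hs Hys] Hy; exists ys => //.
  elim: gs ys Hs Hys {Hy} => [|g gs IH] [|z ys] //= [Hs] Hys.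
  by split; [exact: (Hys 0) | apply: IH => // i; apply: (Hys i.+1)].
Qed.

Section Closure.
Variable k : nat.
Implicit Types F G N : seq nat -> nat.

Lemma rec_ext F G : F =1 G -> recursive k F -> recursive k G.
Proof. by move=> FG [c Hc]; exists c => v /Hc; rewrite FG. Qed.

Lemma rec_nth i : recursive k (fun v => nth 0 v i).
Proof. by exists (MuProj i). Qed.

Lemma rec_seq (F : seq nat -> nat) (Gs : seq (seq nat -> nat)) :
  recursive (size Gs) F ->
  (forall i, i < size Gs -> recursive k (nth (fun=> 0) Gs i)) ->
  recursive k (fun v => F [seq G v | G <- Gs]).
Proof.
move=> [c Hc] HG.
have [gs sgs Hgs] : exists2 gs, size gs = size Gs &
    forall i, i < size Gs -> forall v, size v = k ->
      computes (nth MuZero gs i) v (nth (fun=> 0) Gs i v).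
  elim: Gs HG {c Hc} => [|G Gs IH] HG; first by exists [::].
  have [c Hc] := HG 0 isT.
  have [i|gs sgs Hgs] := IH; first exact: (HG i.+1).
  by exists (c :: gs) => [|[_ v /Hc|i /Hgs]] //=; rewrite sgs.
exists (MuComp c gs) => v sv; apply/computes_Comp.
exists [seq G v | G <- Gs]; last by apply: Hc; rewrite size_map.
rewrite size_map sgs; split=> // i iG.
by rewrite (nth_map (fun=> 0)) //; apply: Hgs.
Qed.

Lemma rec_app1 (f : nat -> nat) F :
  recursive 1 (fun v => f (nth 0 v 0)) -> recursive k F ->
  recursive k (fun v => f (F v)).
Proof. by move=> Hf HF; apply: (@rec_seq _ [:: F] Hf) => -[]. Qed.

Lemma rec_app2 (f : nat -> nat -> nat) F G :
  recursive 2 (fun v => f (nth 0 v 0) (nth 0 v 1)) ->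
  recursive k F -> recursive k G ->
  recursive k (fun v => f (F v) (G v)).
Proof. by move=> Hf HF HG; apply: (@rec_seq _ [:: F; G] Hf) => -[|[]]. Qed.

Lemma rec_app3 (f : nat -> nat -> nat -> nat) F G H :
  recursive 3 (fun v => f (nth 0 v 0) (nth 0 v 1) (nth 0 v 2)) ->
  recursive k F -> recursive k G -> recursive k H ->
  recursive k (fun v => f (F v) (G v) (H v)).
Proof.
by move=> Hf HF HG HH; apply: (@rec_seq _ [:: F; G; H] Hf) => -[|[|[]]].
Qed.

Lemma rec_succ F : recursive k F -> recursive k (fun v => (F v).+1).
Proof. by apply: rec_app1; exists MuSucc => -[|? []]. Qed.

Lemma rec_const n : recursive k (fun=> n).
Proof. by elim: n => [|n]; [exists MuZero | apply: rec_succ]. Qed.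

(** [MuRec] reads its number of steps at the head of the arguments; composing
    with the k projections puts the value of N there. *)
Lemma rec_iteri N F (B : nat -> nat -> seq nat -> nat) :
  recursive k N -> recursive k F ->
  recursive k.+2 (fun w => B (nth 0 w 0) (nth 0 w 1) (behead (behead w))) ->
  recursive k (fun v => iteri (N v) (fun i z => B i z v) (F v)).
Proof.
move=> HN [cF HF] [cB HB].
pose R w := iteri (head 0 w) (fun i z => B i z (behead w)) (F (behead w)).
have HR : recursive k.+1 R.
  exists (MuRec cF cB) => w sw.
  have sbw : size (behead w) = k by rewrite size_behead sw.
  exists (fun i => iteri i (fun i z => B i z (behead w)) (F (behead w))).
  by split=> //= [|i _]; [apply: HF | apply: HB; rewrite /= sbw].
pose Gs := N :: [seq (fun v => nth 0 v i) | i <- iota 0 k].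
have sG : size Gs = k.+1 by rewrite /= size_map size_iota.
have : recursive k (fun v => R [seq G v | G <- Gs]).
  apply: rec_seq; rewrite sG // => -[|i] // ik.
  by rewrite /= (nth_map 0) ?size_iota //; apply: rec_nth.
case=> c Hc; exists c => v sv; move: (Hc v sv); rewrite /R /= -map_comp.
suff -> : [seq ((fun G => G v) \o (fun i v => nth 0 v i)) i | i <- iota 0 k] = v by [].
by rewrite -[RHS](mkseq_nth 0) sv.
Qed.

End Closure.

Lemma rec_behead k F :
  recursive k F -> recursive k.+1 (fun w => F (behead w)).
Proof.
move=> HF; pose Gs := [seq (fun w => nth 0 w i.+1) | i <- iota 0 k].
have sG : size Gs = k by rewrite size_map size_iota.
have [||c Hc] := @rec_seq k.+1 F Gs; first by rewrite sG.
  move=> i; rewrite sG => ik.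
  by rewrite (nth_map 0) ?size_iota //; apply: rec_nth.
exists c => v sv; move: (Hc v sv); rewrite -map_comp.
suff -> : [seq ((fun G => G v) \o (fun i v => nth 0 v i.+1)) i | i <- iota 0 k]
    = behead v by [].
rewrite -[RHS](mkseq_nth 0) size_behead sv.
by apply: eq_map => i; rewrite /= nth_behead.
Qed.

Lemma rec_nth_behead k i : recursive k (fun w => nth 0 (behead w) i).
Proof. by apply: rec_ext (rec_nth _ i.+1) => v; rewrite nth_behead. Qed.

Lemma rec_nth_behead2 k i : recursive k (fun w => nth 0 (behead (behead w)) i).
Proof. by apply: rec_ext (rec_nth _ i.+2) => v; rewrite !nth_behead. Qed.

Lemma rec_nth_behead3 k i :
  recursive k (fun w => nth 0 (behead (behead (behead w))) i).
Proof. by apply: rec_ext (rec_nth _ i.+3) => v; rewrite !nth_behead. Qed.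

Lemma rec_iter k N F (B : nat -> seq nat -> nat) :
  recursive k N -> recursive k F ->
  recursive k.+1 (fun w => B (nth 0 w 0) (behead w)) ->
  recursive k (fun v => iter (N v) (fun z => B z v) (F v)).
Proof.
move=> HN HF HB.
apply: rec_ext (rec_iteri (B := fun _ z v => B z v) HN HF _) => [v|].
  by elim: (N v) => //= n ->.
by apply: rec_ext (rec_behead HB) => w; rewrite nth_behead.
Qed.

Lemma rec_pred k F : recursive k F -> recursive k (fun v => (F v).-1).
Proof.
move=> HF.
apply: rec_ext (rec_iteri (B := fun i _ _ => i) HF (rec_const k 0) (rec_nth _ 0)).
by move=> v; case: (F v).
Qed.

Lemma rec_add k F G :
  recursive k F -> recursive k G -> recursive k (fun v => F v + G v).
Proof.
move=> HF HG; apply: rec_ext (rec_iter (B := fun z _ => z.+1) HG HF _) => [v|].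
  by elim: (G v) => [|n /= ->]; rewrite ?addn0 ?addnS.
exact/rec_succ/rec_nth.
Qed.

Lemma rec_sub k F G :
  recursive k F -> recursive k G -> recursive k (fun v => F v - G v).
Proof.
move=> HF HG; apply: rec_ext (rec_iter (B := fun z _ => z.-1) HG HF _) => [v|].
  by elim: (G v) => [|n /= ->]; rewrite ?subn0 ?subnS.
exact/rec_pred/rec_nth.
Qed.

Lemma rec_mul k F G :
  recursive k F -> recursive k G -> recursive k (fun v => F v * G v).
Proof.
move=> HF HG.
apply: rec_ext (rec_iter (B := fun z v => F v + z) HG (rec_const k 0) _) => [v|].
  by elim: (G v) => [|n /= ->]; rewrite ?muln0 ?mulnS.
by apply: rec_add; [apply: rec_behead | apply: rec_nth].
Qed.

Lemma rec_exp2 k F : recursive k F -> recursive k (fun v => 2 ^ F v).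
Proof.
move=> HF.
apply: rec_ext (rec_iter (B := fun z _ => 2 * z) HF (rec_const k 1) _) => [v|].
  by elim: (F v) => [|n /= ->]; rewrite ?expnS.
by apply: rec_mul; [apply: rec_const | apply: rec_nth].
Qed.

Lemma rec_double k F : recursive k F -> recursive k (fun v => (F v).*2).
Proof.
by move=> HF; apply: rec_ext (rec_add HF HF) => v; rewrite addnn.
Qed.

Lemma rec_eqn k F G : recursive k F -> recursive k G ->
  recursive k (fun v => nat_of_bool (F v == G v)).
Proof.
move=> HF HG; apply: rec_ext (rec_sub (rec_const _ 1)
  (rec_add (rec_sub HF HG) (rec_sub HG HF))) => v; lia.
Qed.

Lemma rec_leq k F G : recursive k F -> recursive k G ->
  recursive k (fun v => nat_of_bool (F v <= G v)).
Proof.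
move=> HF HG; apply: rec_ext (rec_sub (rec_const _ 1) (rec_sub HF HG)) => v; lia.
Qed.

Section Booleans.
Variable k : nat.
Implicit Types P Q : seq nat -> bool.

Lemma rec_negb P : recursive k (fun v => nat_of_bool (P v)) ->
  recursive k (fun v => nat_of_bool (~~ P v)).
Proof.
by move=> HP; apply: rec_ext (rec_sub (rec_const _ 1) HP) => v; case: (P v).
Qed.

Lemma rec_andb P Q :
  recursive k (fun v => nat_of_bool (P v)) ->
  recursive k (fun v => nat_of_bool (Q v)) ->
  recursive k (fun v => nat_of_bool (P v && Q v)).
Proof.
by move=> HP HQ; apply: rec_ext (rec_mul HP HQ) => v; case: (P v); case: (Q v).
Qed.

Lemma rec_orb P Q :
  recursive k (fun v => nat_of_bool (P v)) ->
  recursive k (fun v => nat_of_bool (Q v)) ->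
  recursive k (fun v => nat_of_bool (P v || Q v)).
Proof.
move=> HP HQ; apply: rec_ext (rec_negb (rec_andb (rec_negb HP) (rec_negb HQ))) => v.
by rewrite negb_and !negbK.
Qed.

Lemma rec_if P F G :
  recursive k (fun v => nat_of_bool (P v)) -> recursive k F -> recursive k G ->
  recursive k (fun v => if P v then F v else G v).
Proof.
move=> HP HF HG; apply: rec_ext (rec_add (rec_mul HP HF)
  (rec_mul (rec_sub (rec_const _ 1) HP) HG)) => v.
by case: (P v); rewrite !(mul0n, mul1n) ?addn0.
Qed.

Lemma rec_ifb P Q R :
  recursive k (fun v => nat_of_bool (P v)) ->
  recursive k (fun v => nat_of_bool (Q v)) ->
  recursive k (fun v => nat_of_bool (R v)) ->
  recursive k (fun v => nat_of_bool (if P v then Q v else R v)).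
Proof.
by move=> HP HQ HR; apply: rec_ext (rec_if HP HQ HR) => v; case: (P v).
Qed.

End Booleans.

Definition bsum n (f : nat -> nat) := iteri n (fun i z => z + f i) 0.
Definition bforall n (p : nat -> bool) := bsum n (fun i => ~~ p i) == 0.
Definition bexists n (p : nat -> bool) := bsum n p != 0.

Lemma bsumE n f : bsum n f = \sum_(i < n) f i.
Proof. by rewrite /bsum; elim: n => [|n /= ->]; rewrite (big_ord0, big_ord_recr). Qed.

Lemma bforallP n (p : nat -> bool) : reflect (forall i, i < n -> p i) (bforall n p).
Proof.
rewrite /bforall bsumE sum_nat_eq0; apply: (iffP forallP) => [H i ltin | H i].
  by move: (H (Ordinal ltin)) => /=; case: (p i).
by rewrite /= H.
Qed.

Lemma bexistsP n (p : nat -> bool) : reflect (exists2 i, i < n & p i) (bexists n p).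
Proof.
rewrite /bexists bsumE sum_nat_eq0 negb_forall.
apply: (iffP existsP) => [[i pi0] | [i ltin pi]].
  by exists i; [exact: ltn_ord | move: pi0; case: (p i)].
by exists (Ordinal ltin); rewrite /= pi.
Qed.

Lemma rec_bsum k N (f : nat -> seq nat -> nat) :
  recursive k N -> recursive k.+1 (fun w => f (nth 0 w 0) (behead w)) ->
  recursive k (fun v => bsum (N v) (fun i => f i v)).
Proof.
move=> HN Hf.
apply: (rec_iteri (B := fun i z v => z + f i v) HN (rec_const k 0)).
apply: rec_add; first exact: rec_nth.
pose Gs := (fun w => nth 0 w 0) :: [seq (fun w => nth 0 w i.+2) | i <- iota 0 k].
have sG : size Gs = k.+1 by rewrite /= size_map size_iota.
have := @rec_seq k.+2 (fun w => f (nth 0 w 0) (behead w)) Gs.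
rewrite sG => /(_ Hf) [[|i] ik|c Hc]; first exact: rec_nth.
  by rewrite /= (nth_map 0) ?size_iota //; apply: rec_nth.
exists c => v sv; move: (Hc v sv); rewrite /= -map_comp.
suff -> : [seq ((fun G => G v) \o (fun i v => nth 0 v i.+2)) i | i <- iota 0 k]
    = behead (behead v) by [].
rewrite -[RHS](mkseq_nth 0) !size_behead sv.
by apply: eq_map => i; rewrite /= !nth_behead.
Qed.

Lemma rec_bforall k N (p : nat -> seq nat -> bool) :
  recursive k N -> recursive k.+1 (fun w => nat_of_bool (p (nth 0 w 0) (behead w))) ->
  recursive k (fun v => nat_of_bool (bforall (N v) (fun i => p i v))).
Proof.
move=> HN Hp; apply: rec_eqn; last exact: rec_const.
by apply: (rec_bsum (f := fun i v => ~~ p i v) HN); apply: rec_negb.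
Qed.

Lemma rec_bexists k N (p : nat -> seq nat -> bool) :
  recursive k N -> recursive k.+1 (fun w => nat_of_bool (p (nth 0 w 0) (behead w))) ->
  recursive k (fun v => nat_of_bool (bexists (N v) (fun i => p i v))).
Proof.
move=> HN Hp; apply: rec_negb; apply: rec_eqn; last exact: rec_const.
exact: (rec_bsum (f := fun i v => p i v) HN).
Qed.

Ltac rec_step := first
  [ assumption | simple apply rec_const | simple apply rec_nth
  | simple apply rec_nth_behead | simple apply rec_nth_behead2
  | simple apply rec_nth_behead3
  | simple apply rec_negb | simple apply rec_andb | simple apply rec_orb
  | simple apply rec_ifb
  | simple apply rec_eqn | simple apply rec_leq
  | simple apply rec_bforall | simple apply rec_bexists
  | simple apply rec_succ | simple apply rec_add | simple apply rec_sub
  | simple apply rec_mul | simple apply rec_exp2 | simple apply rec_double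
  | simple apply rec_pred
  | simple apply rec_bsum | simple apply rec_if ].
(* Extended below, as closure lemmas for further functions become available. *)
Ltac rec_more := fail.
Ltac rec_tac := repeat (cbv beta; first [rec_step | rec_more]).

Lemma sum_ltn m b : b <= m -> \sum_(i < m) (i < b : nat) = b.
Proof.
elim: m b => [|m IH] b; first by rewrite leqn0 big_ord0 => /eqP.
rewrite leq_eqVlt => /predU1P[->|ltb].
  by under eq_bigr => i _ do rewrite ltn_ord; rewrite sum1_card card_ord.
by rewrite big_ord_recr /= IH // ltnNge -ltnS ltb addn0.
Qed.

Lemma rec_div k F G : recursive k F -> recursive k G -> (forall v, 0 < G v) ->
  recursive k (fun v => F v %/ G v).
Proof.
move=> HF HG G0.
(* The quotient counts the positive multiples of G v up to F v. *)
have H : recursive k (fun v => bsum (F v) (fun i => i.+1 * G v <= F v)).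
  by rec_tac; apply: rec_behead.
apply: rec_ext H => v; rewrite bsumE -[RHS](sum_ltn (leq_div (F v) (G v))).
by apply: eq_bigr => i _; rewrite leq_divRL.
Qed.
(** * Certificates of computations *)

Local Notation code := CodeSeq.code.
Local Arguments CodeSeq.code : simpl never.

(** As [code (n :: v)] is [2 ^ n] times the odd number [(code v).*2.+1], the
    head of the list coded by u is the exponent of 2 in u, counted here as the
    number of i such that [2 ^ i.+1] divides u. *)
Definition chead u := bsum u (fun i => u %/ 2 ^ i.+1 * 2 ^ i.+1 == u).
Definition ctail u := u %/ 2 ^ (chead u).+1.
Definition ccons n u := 2 ^ n * u.*2.+1.
Definition cnth u i := chead (iter i ctail u).

Lemma chead_cons n u : chead (ccons n u) = n.
Proof.
rewrite /chead bsumE; set m := ccons n u.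
have m0 : 0 < m by rewrite /m /ccons muln_gt0 expn_gt0.
have Hn : logn 2 m = n.
  rewrite /m /ccons lognM ?expn_gt0 // pfactorK // logn_coprime ?addn0 //.
  by rewrite coprime2n /= odd_double.
have le_nm : n <= m.
  apply: leq_trans (ltnW (ltn_expl n (isT : 1 < 2))) _.
  by rewrite /m /ccons leq_pmulr.
rewrite -[RHS](sum_ltn le_nm); apply: eq_bigr => i _.
by rewrite -dvdn_eq pfactor_dvdn // Hn.
Qed.

Lemma ctail_cons n u : ctail (ccons n u) = u.
Proof.
rewrite /ctail chead_cons /ccons expnS mulnC divnMr ?expn_gt0 //.
by rewrite -addn1 -muln2 divnMDl // addn0.
Qed.

Lemma ccons_eq0 n u : (ccons n u == 0) = false.
Proof. by rewrite muln_eq0 expn_eq0. Qed.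

Lemma chead_code v : chead (code v) = head 0 v.
Proof. by case: v => [|n v] //; apply: chead_cons. Qed.

Lemma ctail_code v : ctail (code v) = code (behead v).
Proof. by case: v => [|n v] //; apply: ctail_cons. Qed.

Lemma iter_ctail_code i v : iter i ctail (code v) = code (drop i v).
Proof.
elim: i => [|i IH]; first by rewrite drop0.
by rewrite iterS IH ctail_code -drop1 drop_drop add1n.
Qed.

Lemma cnth_code v i : cnth (code v) i = nth 0 v i.
Proof. by rewrite /cnth iter_ctail_code chead_code -nth0 nth_drop addn0. Qed.

Lemma ccons_code n v : ccons n (code v) = code (n :: v).
Proof. by []. Qed.

Lemma ccons_eta u : u != 0 -> u = ccons (chead u) (ctail u).
Proof.
rewrite -{1 2}(CodeSeq.decodeK u) => u0.
rewrite -[u in RHS]CodeSeq.decodeK chead_code ctail_code.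
by case: (CodeSeq.decode u) u0.
Qed.

Lemma index_lt_code i (v : seq nat) : i < size v -> i < code v.
Proof.
elim: v i => [|n v IH] // i; rewrite -ccons_code /ccons => iv.
apply: leq_trans (leq_pmull _ _); last by rewrite expn_gt0.
by case: i iv => [|i] // /IH; lia.
Qed.

Lemma rec_chead k F : recursive k F -> recursive k (fun v => chead (F v)).
Proof.
apply: rec_app1; rewrite /chead; rec_tac; apply: rec_div; rec_tac => v.
by rewrite expn_gt0.
Qed.

Lemma rec_ctail k F : recursive k F -> recursive k (fun v => ctail (F v)).
Proof.
apply: rec_app1; rewrite /ctail; apply: rec_div => [||v]; last by rewrite expn_gt0.
  exact: rec_nth.
by apply/rec_exp2/rec_succ/rec_chead/rec_nth.
Qed.

Lemma rec_ccons k F G : recursive k F -> recursive k G ->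
  recursive k (fun v => ccons (F v) (G v)).
Proof. by apply: rec_app2; rewrite /ccons; rec_tac. Qed.

Lemma rec_cnth k F G : recursive k F -> recursive k G ->
  recursive k (fun v => cnth (F v) (G v)).
Proof.
apply: rec_app2; apply: rec_chead.
apply: (rec_iter (B := fun u _ => ctail u)); rec_tac.
exact/rec_ctail/rec_nth.
Qed.

Ltac rec_more ::= first [ simple apply rec_chead | simple apply rec_ctail
  | simple apply rec_ccons | simple apply rec_cnth ].

Fixpoint mucode_code (c : mucode) : nat :=
  match c with
  | MuZero => code [:: 0]
  | MuSucc => code [:: 1]
  | MuProj i => code [:: 2; i]
  | MuComp f gs => code [:: 3; mucode_code f; code (map mucode_code gs)]
  | MuRec f g => code [:: 4; mucode_code f; mucode_code g]
  | MuMin f => code [:: 5; mucode_code f]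
  end.

(** A fact is coded as a list of four numbers, the first of which says how to
    read the others: with 0, the program c has the value y on the arguments v;
    with 1, the programs of the list c have on v the values of the list y;
    with 2, the program c has a nonzero value on [m :: v] for all m < y. *)
Definition fact t c v y := ccons t (ccons c (ccons v (ccons y 0))).

Lemma rec_fact k F1 F2 F3 F4 : recursive k F1 -> recursive k F2 ->
  recursive k F3 -> recursive k F4 ->
  recursive k (fun v => fact (F1 v) (F2 v) (F3 v) (F4 v)).
Proof. by move=> *; rewrite /fact; rec_tac. Qed.

Ltac rec_more ::= first [ simple apply rec_chead | simple apply rec_ctail
  | simple apply rec_ccons | simple apply rec_cnth | simple apply rec_fact ].

(** The premises p and q of the fact with components c, v and y.  Intermediate
    values, such as the list of values of the inner functions of a composition,
    are read off the premises ([cnth p 3]), which avoids searching for them. *)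
Definition eval_rule c v y p q : bool :=
  if chead c == 0 then y == 0
  else if chead c == 1 then y == (chead v).+1
  else if chead c == 2 then y == cnth v (cnth c 1)
  else if chead c == 3 then
    (p == fact 1 (cnth c 2) v (cnth p 3)) &&
    (q == fact 0 (cnth c 1) (cnth p 3) y)
  else if chead c == 4 then
    if chead v == 0 then p == fact 0 (cnth c 1) (ctail v) y
    else (p == fact 0 c (ccons (chead v).-1 (ctail v)) (cnth p 3)) &&
      (q == fact 0 (cnth c 2)
              (ccons (chead v).-1 (ccons (cnth p 3) (ctail v))) y)
  else (p == fact 2 (cnth c 1) v y) && (q == fact 0 (cnth c 1) (ccons y v) 0).

Definition eval_all_rule c v y p q : bool :=
  if c == 0 then y == 0
  else [&& y != 0, p == fact 0 (chead c) v (chead y)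
         & q == fact 1 (ctail c) v (ctail y)].

Definition nonzero_below_rule c v y p q : bool :=
  (y == 0) ||
  [&& p == fact 2 c v y.-1, q == fact 0 c (ccons y.-1 v) (cnth q 3)
    & cnth q 3 != 0].

Definition rule x p q : bool :=
  if cnth x 0 == 0 then eval_rule (cnth x 1) (cnth x 2) (cnth x 3) p q
  else if cnth x 0 == 1 then eval_all_rule (cnth x 1) (cnth x 2) (cnth x 3) p q
  else nonzero_below_rule (cnth x 1) (cnth x 2) (cnth x 3) p q.

Lemma rec_rule k F G H : recursive k F -> recursive k G -> recursive k H ->
  recursive k (fun v => nat_of_bool (rule (F v) (G v) (H v))).
Proof.
move=> HF HG HH.
have Hr : recursive 3 (fun v => nat_of_bool (rule (nth 0 v 0) (nth 0 v 1) (nth 0 v 2))).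
  rewrite /rule /eval_rule /eval_all_rule /nonzero_below_rule; rec_tac.
exact: (rec_app3 (f := fun a b c => nat_of_bool (rule a b c)) Hr HF HG HH).
Qed.

(** The order of the facts in the list does not matter, and nothing excludes
    circular justifications.  They cannot occur below a fact about an actual
    program, since each premise has a smaller program or a smaller recursion
    argument. *)
Definition certificate s : bool :=
  bforall s (fun i => bexists s (fun j => bexists s (fun l =>
    rule (cnth s i) (cnth s j) (cnth s l)))).

Definition certifies n s y : bool :=
  (chead s == fact 0 n (ccons n 0) y) && certificate s.

Lemma rec_certifies k F G H : recursive k F -> recursive k G -> recursive k H ->
  recursive k (fun v => nat_of_bool (certifies (F v) (G v) (H v))).
Proof.
move=> HF HG HH.
suff Hr : recursive 3 (fun v => nat_of_bool
    (certifies (nth 0 v 0) (nth 0 v 1) (nth 0 v 2))).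
  exact: (rec_app3 (f := fun a b c => nat_of_bool (certifies a b c)) Hr HF HG HH).
rewrite /certifies /certificate; rec_tac.
by apply: rec_rule; rec_tac.
Qed.

(** In a set of facts closed under the rules, a fact about a program that halts
    states the right value: this is all the soundness that is needed, and it
    follows by induction on the program. *)
Section Uniqueness.
Variable S : nat -> Prop.
Hypothesis Sclosed : forall x, S x -> exists p q, [/\ S p, S q & rule x p q].

Lemma fact0P c v y : S (fact 0 c v y) ->
  exists p q, [/\ S p, S q & eval_rule c v y p q].
Proof.
move/Sclosed=> [p [q [Sp Sq]]]; rewrite /rule /fact -[0]/(code [::]) !ccons_code.
by rewrite !cnth_code => H; exists p, q.
Qed.

Lemma fact1P c v y : S (fact 1 c v y) ->
  exists p q, [/\ S p, S q & eval_all_rule c v y p q].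
Proof.
move/Sclosed=> [p [q [Sp Sq]]]; rewrite /rule /fact -[0]/(code [::]) !ccons_code.
by rewrite !cnth_code => H; exists p, q.
Qed.

Lemma fact2P c v y : S (fact 2 c v y) ->
  exists p q, [/\ S p, S q & nonzero_below_rule c v y p q].
Proof.
move/Sclosed=> [p [q [Sp Sq]]]; rewrite /rule /fact -[0]/(code [::]) !ccons_code.
by rewrite !cnth_code => H; exists p, q.
Qed.

(** A false fact about [MuMin] is refuted at the smaller of the claimed and the
    true value; here the claimed one is the larger. *)
Lemma nonzero_belowP c v y m : S (fact 2 c v y) -> m < y ->
  exists2 z, z != 0 & S (fact 0 c (ccons m v) z).
Proof.
elim: y => // y IH Sy; rewrite ltnS leq_eqVlt.
have [p [q [Sp Sq /= /and3P[/eqP Ep /eqP Eq z0]]]] := fact2P Sy.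
case/predU1P=> [->|]; last by apply: IH; rewrite -Ep.
by exists (cnth q 3); rewrite -?Eq.
Qed.

Definition unique_value c := forall v y y', computes c v y ->
  S (fact 0 (mucode_code c) (code v) y') -> y' = y.

Lemma unique_values gs : (forall g, List.In g gs -> unique_value g) ->
  forall v ys y', size ys = size gs ->
  (forall i, i < size gs -> computes (nth MuZero gs i) v (nth 0 ys i)) ->
  S (fact 1 (code (map mucode_code gs)) (code v) y') -> y' = code ys.
Proof.
elim: gs => [|g gs IH] Hgs v [|y ys] //= y' => [_ _|[sys] Hys] /fact1P.
  by case=> p [q [_ _ /eqP]].
case=> p [q [Sp Sq]]; rewrite /eval_all_rule -!/(ccons _ _).
rewrite chead_cons ctail_cons ccons_eq0 => /and3P[y0 /eqP Ep /eqP Eq].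
rewrite (ccons_eta y0); congr ccons.
  by apply: (Hgs g _ v); [left | exact: (Hys 0) | rewrite -Ep].
apply: (IH _ v) sys _ _ => [h Hh|i|]; first by apply: Hgs; right.
  exact: (Hys i.+1).
by rewrite -Eq.
Qed.

(** The induction principle generated for [mucode] gives no hypothesis for the
    programs in the list under [MuComp]. *)
Lemma mucode_rect_all (P : mucode -> Prop) :
  P MuZero -> P MuSucc -> (forall i, P (MuProj i)) ->
  (forall f gs, P f -> (forall g, List.In g gs -> P g) -> P (MuComp f gs)) ->
  (forall f g, P f -> P g -> P (MuRec f g)) ->
  (forall f, P f -> P (MuMin f)) ->
  forall c, P c.
Proof.
move=> H0 HS Hp Hc Hr Hm; fix IH 1; case=> [||i|f gs|f g|f].
- exact: H0.
- exact: HS.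
- exact: Hp.
- apply: Hc (IH f) _; elim: gs => [_ []|g gs IHgs] h [<-|/IHgs]; last exact.
  exact: IH.
- exact: Hr (IH f) (IH g).
- exact: Hm (IH f).
Qed.

Lemma unique_valueP c : unique_value c.
Proof.
elim/mucode_rect_all: c => [||i|f gs IHf IHgs|f g IHf IHg|f IHf] v y y'.
- by move=> /= -> /fact0P[p [q [_ _ /eqP]]].
- move=> -> /fact0P[p [q [_ _]]].
  by rewrite /eval_rule /= !(chead_code, cnth_code) => /eqP.
- move=> -> /fact0P[p [q [_ _]]].
  by rewrite /eval_rule /= !(chead_code, cnth_code) => /eqP.
- case/computes_Comp=> ys [sys Hys] Hy /fact0P[p [q [Sp Sq]]].
  rewrite /eval_rule /= !(chead_code, cnth_code) /= => /andP[/eqP Ep /eqP Eq].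
  apply: IHf Hy _.
  by rewrite -(unique_values IHgs sys Hys (y' := cnth p 3)) -?Ep // -Eq.
- case=> s [H0 HS ->] Sy.
  rewrite [mucode_code _]/= in Sy; set c := code _ in Sy.
  have H i u y1 : chead u = i -> ctail u = code (behead v) ->
     S (fact 0 c u y1) -> i <= head 0 v -> y1 = s i.
    elim: i u y1 => [|i IHi] u y1 Ehd Etl /fact0P[p [q [Sp Sq]]];
      rewrite /eval_rule !(chead_code, cnth_code) Ehd Etl /=.
      by move=> /eqP Ep _; apply: IHf H0 _; rewrite -Ep.
    move=> /andP[/eqP Ep /eqP Eq] lti; apply: IHg (HS i lti) _.
    have <- : cnth p 3 = s i.
      apply: (IHi (ccons i (code (behead v)))) (ltnW lti);
        by rewrite ?chead_cons ?ctail_cons -?Ep.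
    by rewrite -!ccons_code -Eq.
  by apply: H Sy _; rewrite ?chead_code ?ctail_code.
- case=> Hy Hlow /fact0P[p [q [Sp Sq]]].
  rewrite /eval_rule /= !(chead_code, cnth_code) /= => /andP[/eqP Ep /eqP Eq].
  have {Ep}Sp : S (fact 2 (mucode_code f) (code v) y') by rewrite -Ep.
  have {Eq}Sq : S (fact 0 (mucode_code f) (code (y' :: v)) 0) by rewrite -Eq.
  case: (ltngtP y' y) => // [/Hlow[z Hz] | lty].
    by have := IHf _ _ _ Hz Sq.
  by have [z z0 /(IHf _ _ _ Hy) Ez] := nonzero_belowP Sp lty; rewrite Ez in z0.
Qed.

End Uniqueness.

Definition derivable x := exists s : seq nat, x \in s /\
  forall z, z \in s -> exists p q, [/\ p \in s, q \in s & rule z p q].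

(** Concatenating two justified lists gives a justified list, so that derivations
    of the premises combine. *)
Lemma derivable_rule x p q :
  derivable p -> derivable q -> rule x p q -> derivable x.
Proof.
move=> [s [ps Hs]] [t [qt Ht]] Hr; exists (x :: s ++ t); split.
  by rewrite inE eqxx.
move=> z; rewrite inE mem_cat => /predU1P[->|/orP[/Hs|/Ht]].
- by exists p, q; rewrite !inE !mem_cat ps qt !orbT.
- by case=> a [b [a_s b_s H]]; exists a, b; rewrite !inE !mem_cat a_s b_s !orbT.
- by case=> a [b [a_t b_t H]]; exists a, b; rewrite !inE !mem_cat a_t b_t !orbT.
Qed.

Lemma derivable_axiom x : rule x x x -> derivable x.
Proof.
move=> Hr; exists [:: x]; rewrite inE eqxx; split=> // z.
by rewrite inE => /eqP ->; exists x, x; rewrite inE eqxx.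
Qed.

Lemma rule_fact t c v y p q : rule (fact t c v y) p q =
  if t == 0 then eval_rule c v y p q
  else if t == 1 then eval_all_rule c v y p q
  else nonzero_below_rule c v y p q.
Proof.
by rewrite /rule /fact -[0]/(code [::]) !ccons_code !cnth_code.
Qed.

Lemma cnth_fact t c v y : cnth (fact t c v y) 3 = y.
Proof. by rewrite /fact -[0]/(code [::]) !ccons_code cnth_code. Qed.

Definition evaluates c v y := derivable (fact 0 (mucode_code c) (code v) y).

Lemma derivable_all gs v ys : size ys = size gs ->
  (forall i, i < size gs ->
     evaluates (nth MuZero gs i) v (nth 0 ys i)) ->
  derivable (fact 1 (code (map mucode_code gs)) (code v) (code ys)).
Proof.
elim: gs ys => [|g gs IH] [|y ys] //= => [_ _|[sys] Hys].
  by apply: derivable_axiom; rewrite rule_fact.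
apply: (derivable_rule (Hys 0 _) (IH ys sys _)) => // [i|]; first exact: (Hys i.+1).
rewrite rule_fact /= /eval_all_rule -!ccons_code !ccons_eq0.
by rewrite !(chead_cons, ctail_cons) !eqxx.
Qed.

Lemma computes_evaluates c v y : computes c v y -> evaluates c v y.
Proof.
elim/mucode_rect_all: c v y => [||i|f gs IHf IHgs|f g IHf IHg|f IHf] v y.
- move=> ->; apply: derivable_axiom.
  by rewrite rule_fact /= /eval_rule chead_code.
- move=> ->; apply: derivable_axiom.
  by rewrite rule_fact /= /eval_rule !chead_code /=.
- move=> ->; apply: derivable_axiom.
  by rewrite rule_fact /= /eval_rule chead_code !cnth_code /=.
- case/computes_Comp=> ys [sys Hys] Hy.
  apply: (derivable_rule (derivable_all sys _) (IHf _ _ Hy)).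
    move=> i ilt; apply: IHgs (Hys i ilt).
    by elim: (gs) i ilt => [|g' gs' IH] [|i] //=; [left | move/IH; right].
  rewrite rule_fact [mucode_code (MuComp f gs)]/= /eval_rule cnth_fact.
  by rewrite !(chead_code, cnth_code) /= !eqxx.
- case=> s [H0 HS ->].
  rewrite /evaluates [mucode_code _]/=; set c := code _.
  have H i u : chead u = i -> ctail u = code (behead v) -> i <= head 0 v ->
      derivable (fact 0 c u (s i)).
    elim: i u => [|i IHi] u Ehd Etl lti.
      apply: derivable_rule (IHf _ _ H0) (IHf _ _ H0) _.
      by rewrite rule_fact /= /eval_rule !(chead_code, cnth_code) Ehd Etl /=.
    apply: derivable_rule (IHi (ccons i (code (behead v))) _ _ (ltnW lti))
        (IHg _ _ (HS _ lti)) _; rewrite ?chead_cons ?ctail_cons //.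
    rewrite rule_fact /= /eval_rule !(chead_code, cnth_code) Ehd Etl /=.
    by rewrite cnth_fact !eqxx.
  by apply: H; rewrite ?chead_code ?ctail_code.
- case=> Hy Hlow.
  have Hm m : m <= y -> derivable (fact 2 (mucode_code f) (code v) m).
    elim: m => [_|m IHm ltm]; first by apply: derivable_axiom; rewrite rule_fact.
    have [z Hz] := Hlow m ltm.
    apply: derivable_rule (IHm (ltnW ltm)) (IHf _ _ Hz) _.
    by rewrite rule_fact /= /nonzero_below_rule cnth_fact !eqxx.
  apply: derivable_rule (Hm y (leqnn _)) (IHf _ _ Hy) _.
  by rewrite rule_fact /= /eval_rule !(chead_code, cnth_code) /= !eqxx.
Qed.

Lemma certifies_complete c y :
  computes c [:: mucode_code c] y -> exists s, certifies (mucode_code c) s y.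
Proof.
case/computes_evaluates=> t [xt Ht]; set x := fact _ _ _ _ in xt.
exists (code (x :: t)); rewrite /certifies chead_code eqxx /=.
have Ht' z : z \in x :: t -> exists p q, [/\ p \in t, q \in t & rule z p q].
  by rewrite inE => /predU1P[->|]; apply: Ht.
have Hix z : z \in t -> exists2 j, j < code (x :: t) & cnth (code (x :: t)) j = z.
  move=> zt; exists (index z t).+1.
    by apply: index_lt_code; rewrite /= ltnS index_mem.
  by rewrite cnth_code /= nth_index.
apply/bforallP => i _; rewrite [X in rule X]cnth_code.
have [lti|lei] := ltnP i (size (x :: t)).
  have [p [q [/Hix[j jlt <-] /Hix[l llt <-] Hr]]] := Ht' _ (mem_nth 0 lti).
  by apply/bexistsP; exists j => //; apply/bexistsP; exists l.
(* Reading past the end of the list gives 0.  As a fact this says that a program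
   with tag 0 has the value 0, which is an axiom. *)
have lt0 : 0 < code (x :: t) by apply: index_lt_code.
apply/bexistsP; exists 0 => //; apply/bexistsP; exists 0 => //.
by rewrite nth_default.
Qed.

Lemma certifies_sound c s y y' :
  computes c [:: mucode_code c] y -> certifies (mucode_code c) s y' -> y' = y.
Proof.
move=> Hy /andP[/eqP Es /bforallP Hs].
pose S x := exists2 i, i < s & cnth s i = x.
apply: (@unique_valueP S) Hy _ => [x [i ilt <-]|].
  have /bexistsP[j jlt /bexistsP[l llt Hr]] := Hs i ilt.
  by exists (cnth s j), (cnth s l); split=> //; [exists j | exists l].
exists 0 => //; rewrite lt0n; apply/eqP => s0.
have := ccons_eq0 0 (ccons (mucode_code c) (ccons (ccons (mucode_code c) 0) (ccons y' 0))).
by rewrite -/(fact _ _ _ _) -Es s0.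
Qed.
(** * The group of words *)

Import Order.TTheory GRing.Theory Num.Theory.
Local Open Scope ring_scope.

Definition delta (m i : int) : int := (i == m)%:R.

Lemma delta_shift m i k : delta (m + k) (i + k) = delta m i.
Proof. by rewrite /delta (inj_eq (addIr k)). Qed.

(** A finitely supported function f on the integers is represented by the linear
    form g |-> sum_i f(i) g(i) on all functions g, and f(m) is its value at
    [delta m].  Then the product of triples involves no sum over a support, and
    it is defined without any finiteness proof. *)
Record triple := Triple {
  cent : nat -> int;
  func : (int -> int) -> int;
  shift : int
}.

Lemma tripleP g h : (forall m, cent g m = cent h m) ->
  (forall f, func g f = func h f) -> shift g = shift h -> g = h.
Proof.
by case: g h => [c f s] [c' f' s'] /= /funext -> /funext -> ->.
Qed.

Section WordGroup.
Variable slope : nat -> int.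

(** The central element with coordinates z on the z_(m+1), modulo the relations.
    The pair of coordinates (2n, 2n+1) belongs to the pair (a_n, c_n); for a
    nonzero slope the multiples of a_n are transferred to c_n. *)
Definition reduce (z : nat -> int) (m : nat) : int :=
  if odd m then z m + slope m./2 * z m.-1 else (slope m./2 == 0)%:R * z m.

Lemma reduceD z z' m : reduce (fun n => z n + z' n) m = reduce z m + reduce z' m.
Proof. by rewrite /reduce; case: odd; ring. Qed.

Lemma reduceM a z m : reduce (fun n => a * z n) m = a * reduce z m.
Proof. by rewrite /reduce; case: odd; ring. Qed.

Lemma reduce0 m : reduce (fun=> 0) m = 0.
Proof. by rewrite /reduce; case: odd; ring. Qed.

Definition triple1 := Triple (fun=> 0) (fun=> 0) 0.

(** The correction to the central part collects z_(j-i) once for each x_i of g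
    that stands to the left of an x_j of h with i < j, after the x's of h have
    been shifted by the power of t in g; pairs with i >= j contribute nothing,
    so that products are ordered with the larger indices to the left. *)
Definition mult g h := Triple
  (fun m => cent g m + cent h m +
     reduce (fun n => func g (fun i =>
       func h (fun j => delta (i + n.+1%:Z) (j + shift g)))) m)
  (fun f => func g f + func h (fun j => f (j + shift g)))
  (shift g + shift h).

(** Letters with index 0 stand for t, all others for x.  Each letter is then
    x^eps t^tau with one of the exponents equal to 0. *)
Definition tau (a : letter) : int :=
  if a.1 == 0%N then if a.2 then -1 else 1 else 0.
Definition eps (a : letter) : int :=
  if a.1 == 0%N then 0 else if a.2 then -1 else 1.

Definition act a g := Triple
  (fun m => cent g m +
     eps a * reduce (fun n => func g (fun i => delta n.+1%:Z (i + tau a))) m)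
  (fun f => eps a * f 0 + func g (fun i => f (i + tau a)))
  (tau a + shift g).

Definition ev (w : word) := foldr act triple1 w.

(** Left multiplication by a letter commutes with right multiplications, so that
    [ev] is a morphism from words to triples.  The associativity of [mult] on
    the image of [ev] comes for free from that of concatenation. *)
Lemma mult_act a g h : mult (act a g) h = act a (mult g h).
Proof.
apply: tripleP => [m|f|] /=; last by rewrite addrA.
  rewrite [X in _ + X = _]reduceD [X in _ + (X + _) = _]reduceM.
  rewrite [X in _ = _ + _ * X]reduceD mulrDr.
  have -> : (fun n : nat => func h (fun j => delta (0 + n.+1%:Z) (j + (tau a + shift g))))
      = (fun n => func h (fun j => delta n.+1%:Z (j + shift g + tau a))).
    by apply/funext => n; congr func; apply/funext => j; congr delta; ring.
  have -> : (fun n : nat => func g (fun i => func h (fun j =>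
               delta (i + tau a + n.+1%:Z) (j + (tau a + shift g)))))
      = (fun n => func g (fun i => func h (fun j =>
               delta (i + n.+1%:Z) (j + shift g)))).
    apply/funext => n; congr func; apply/funext => i; congr func.
    apply/funext => j; rewrite -[RHS](delta_shift _ _ (tau a)); congr delta; ring.
  by ring.
rewrite -addrA; congr (_ + (_ + _)).
by congr func; apply/funext => j; congr f; ring.
Qed.

Lemma mul1_triple g : mult triple1 g = g.
Proof.
apply: tripleP => [m|f|] /=; rewrite ?reduce0 ?add0r ?addr0 //.
by congr func; apply/funext => j; rewrite addr0.
Qed.

Lemma ev_cat u v : ev (u ++ v) = mult (ev u) (ev v).
Proof. by elim: u => [|a u /= ->]; rewrite ?mul1_triple ?mult_act. Qed.

Definition linv (a : letter) : letter := (a.1, ~~ a.2).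
Definition winv (w : word) : word := rev (map linv w).

Lemma linvK : involutive linv.
Proof. by case=> i b; rewrite /linv negbK. Qed.

Lemma winvK : involutive winv.
Proof. by move=> w; rewrite /winv map_rev revK mapK //; apply: linvK. Qed.

Lemma act_linv a g : act (linv a) (act a g) = g.
Proof.
case: a => i b; apply: tripleP => [m|f|] /=; rewrite /eps /tau /=;
  case: (i == 0%N); rewrite ?mul0r ?addr0 ?add0r //.
- have -> : (fun n : nat => (if b then -1 else 1) * delta n.+1%:Z (0 + 0) +
      func g (fun i0 => delta n.+1%:Z (i0 + 0 + 0))) =
      (fun n => func g (fun i0 => delta n.+1%:Z (i0 + 0))).
    apply/funext => n; rewrite /delta mulr0 add0r.
    by congr func; apply/funext => j; rewrite addr0.
  by case: b => /=; ring.
- by congr func; apply/funext => j; congr f; case: b => /=; ring.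
- have -> : (fun j => f (j + 0 + 0)) = f by apply/funext => j; rewrite !addr0.
  by case: b => /=; ring.
- by case: b => /=; ring.
Qed.

Lemma ev_winvl w : ev (winv w ++ w) = triple1.
Proof.
rewrite /winv; elim: w => // a w IH.
by rewrite /= rev_cons cat_rcons /ev !foldr_cat /= act_linv -foldr_cat.
Qed.

Lemma ev_winvr w : ev (w ++ winv w) = triple1.
Proof. by rewrite -{1}(winvK w) ev_winvl. Qed.

(** On arbitrary triples [mult] is not associative, since [func] need not be
    additive: the group consists of the values of words. *)
Record elt := Elt { val_elt : triple; elt_word : exists w, ev w = val_elt }.

Lemma elt_inj g h : val_elt g = val_elt h -> g = h.
Proof.
case: g h => [g Hg] [h Hh] /= E; case: _ / E Hh => Hh.
by congr Elt; apply: Prop_irrelevance.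
Qed.

Definition of_word w := Elt (ex_intro (fun u => ev u = ev w) w erefl).

Lemma of_wordP g : exists w, g = of_word w.
Proof. by case: (elt_word g) => w E; exists w; apply: elt_inj. Qed.

Definition word_of g := sval (cid (elt_word g)).

Lemma word_ofK g : of_word (word_of g) = g.
Proof. by rewrite /word_of; case: cid => w E; apply: elt_inj. Qed.

Definition elt_mul g h := of_word (word_of g ++ word_of h).
Definition elt_inv g := of_word (winv (word_of g)).
Definition elt_one := of_word [::].

Lemma ev_word_of g : ev (word_of g) = val_elt g.
Proof. by rewrite -{2}(word_ofK g). Qed.

Lemma val_elt_mul g h : val_elt (elt_mul g h) = mult (val_elt g) (val_elt h).
Proof. by rewrite /= ev_cat !ev_word_of. Qed.

Lemma elt_mul_word u v : elt_mul (of_word u) (of_word v) = of_word (u ++ v).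
Proof. by apply: elt_inj; rewrite val_elt_mul /= ev_cat. Qed.

Lemma elt_mulA : associative elt_mul.
Proof.
move=> g h k.
have [[u ->] [v ->] [w ->]] := And3 (of_wordP g) (of_wordP h) (of_wordP k).
by rewrite !elt_mul_word catA.
Qed.

Lemma elt_mul1 : left_id elt_one elt_mul.
Proof. by move=> g; apply: elt_inj; rewrite val_elt_mul /= mul1_triple. Qed.

Lemma elt_mulr1 : right_id elt_one elt_mul.
Proof. by move=> g; have [u ->] := of_wordP g; rewrite elt_mul_word cats0. Qed.

Lemma elt_mulV : left_inverse elt_one elt_inv elt_mul.
Proof.
move=> g; rewrite -{2}(word_ofK g) elt_mul_word; apply: elt_inj.
exact: ev_winvl.
Qed.

Lemma elt_mulrV : right_inverse elt_one elt_inv elt_mul.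
Proof.
move=> g; rewrite -{1}(word_ofK g) elt_mul_word; apply: elt_inj.
exact: ev_winvr.
Qed.

HB.instance Definition _ := gen_eqMixin elt.
HB.instance Definition _ := gen_choiceMixin elt.
HB.instance Definition _ :=
  isGroup.Build elt elt_mulA elt_mul1 elt_mulr1 elt_mulV elt_mulrV.

Definition gen (i : nat) : elt := of_word [:: (i, false)].

Lemma val_mulg (g h : elt) : val_elt (g * h)%g = mult (val_elt g) (val_elt h).
Proof. exact: val_elt_mul. Qed.

Lemma mul_of_word u v : (of_word u * of_word v)%g = of_word (u ++ v).
Proof. exact: elt_mul_word. Qed.

Lemma of_word_inv w : (of_word w)^-1%g = of_word (winv w).
Proof.
apply: (mulgI (of_word w)); rewrite mulgV mul_of_word.
by apply: elt_inj; rewrite /= ev_winvr.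
Qed.

Lemma word_value_gen w : word_value gen w = of_word w.
Proof.
rewrite /word_value; elim: w => [|[i b] w IH]; first by rewrite big_nil.
rewrite big_cons IH -cat1s -mul_of_word; congr (_ * _)%g.
by case: b => //=; rewrite /gen of_word_inv.
Qed.

Lemma gen_index i : gen i.+1 = gen 1.
Proof. exact: elt_inj. Qed.

Lemma generated_word (S : elt -> Prop) w :
  (forall i, generated S (gen i)) -> generated S (of_word w).
Proof.
move=> H; rewrite -word_value_gen /word_value.
elim: w => [|[i b] w IH]; first by rewrite big_nil; apply: generated_one.
rewrite big_cons; apply: generated_mul IH.
by case: b => /=; [apply: generated_inv|].
Qed.

Lemma elt_two_generated : two_generated elt.
Proof.
exists (gen 0), (gen 1) => g; have [w ->] := of_wordP g.
apply: generated_word => -[|i]; first by apply: generated_mem; left.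
by rewrite gen_index; apply: generated_mem; right.
Qed.

Lemma generating_gen : generating (Some 2%N) gen.
Proof.
move=> g; have [w ->] := of_wordP g.
apply: generated_word => -[|i]; first by apply: generated_mem; exists 0%N.
by rewrite gen_index; apply: generated_mem; exists 1%N.
Qed.

End WordGroup.
(** * The bi-order *)

Section Order.

Definition lex_pos d (T : orderType d) (F : T -> int) : Prop :=
  exists m, 0 < F m /\ forall i, (i < m)%O -> F i = 0.

Lemma lex_posD d (T : orderType d) (F F' : T -> int) :
  lex_pos F -> lex_pos F' -> lex_pos (fun i => F i + F' i).
Proof.
move=> [m [Fm F0]] [m' [Fm' F0']].
case: (ltgtP m m') => [lt|lt|E].
- exists m; rewrite F0' // addr0; split=> // i im.
  by rewrite F0 // F0' // (lt_trans im).
- exists m'; rewrite F0 // add0r; split=> // i im.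
  by rewrite F0' // F0 // (lt_trans im).
- rewrite -{m'}E in Fm' F0'.
  by exists m; rewrite addr_gt0 //; split=> // i im; rewrite F0 ?F0'.
Qed.

Lemma lex_pos_nat (F : nat -> int) : ~ (forall m, F m = 0) ->
  lex_pos F \/ lex_pos (fun m => - F m).
Proof.
move/existsNP=> [m0 /eqP Fm0].
have [|m Fm Hm] := @ex_minnP (fun m => F m != 0); first by exists m0.
have H0 i : (i < m)%O -> F i = 0.
  move=> im; apply/eqP; apply: contraTT im => /Hm; by rewrite -leNgt.
have [lt|le] := ltP 0 (F m); first by left; exists m.
right; exists m; rewrite oppr_gt0 lt_neqAle Fm le; split=> // i /H0 ->.
by rewrite oppr0.
Qed.

Lemma lex_pos_int (F : int -> int) (b : int) : (forall m, m < b -> F m = 0) ->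
  ~ (forall m, F m = 0) -> lex_pos F \/ lex_pos (fun m => - F m).
Proof.
move=> Fb F0.
have H (E : int -> int) : (forall m, m < b -> E m = 0) ->
    lex_pos (fun n : nat => E (n%:Z + b)) -> lex_pos E.
  move=> Eb [m [Em Hm]]; exists (m%:Z + b); split=> // i im.
  have [ib|bi] := ltP i b; first exact: Eb.
  have E1 : i = `|i - b|%N%:Z + b by lia.
  by rewrite E1; apply: Hm; rewrite ltEnat /=; lia.
have [E|E|E] := @lex_pos_nat (fun n => F (n%:Z + b)); last 2 first.
- by left; apply: H Fb E.
- by right; apply: (H (fun m => - F m)) E => m /Fb ->; rewrite oppr0.
apply: F0 => m; have [/Fb //|bm] := ltP m b.
by have := E `|m - b|%N; rewrite (_ : _ + b = m) //; lia.
Qed.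

Lemma bi_order_of_cone (G : groupType) (pos : G -> Prop) :
  ~ pos 1%g ->
  (forall g h, pos g -> pos h -> pos (g * h)%g) ->
  (forall g k, pos g -> pos (k^-1 * g * k)%g) ->
  (forall g, g <> 1%g -> pos g \/ pos g^-1%g) ->
  bi_order (fun g h => g = h \/ pos (g^-1 * h)%g).
Proof.
move=> pos1 posM posJ posV; split.
- by left.
- move=> g h [//|gh] [//|hg]; case: pos1.
  by have := posM _ _ gh hg; rewrite mulgA mulgK mulVg.
- move=> g h k [-> //|gh] [<-|hk]; first by right.
  by right; have := posM _ _ gh hk; rewrite mulgA mulgK.
- move=> g h; have [->|ne] := pselect (g = h); first by left; left.
  have [|H|H] := posV (g^-1 * h)%g; first by move/mulg1_eq; rewrite invgK.
    by left; right.
  by right; right; move: H; rewrite invgM invgK.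
- move=> k g h [->|gh]; [by left | right].
  by rewrite invgM -mulgA mulKg.
- move=> k g h [->|gh]; [by left | right].
  by rewrite invgM mulgA -(mulgA k^-1%g); apply: posJ.
Qed.

Lemma generated_ind (H : groupType) (S P : H -> Prop) :
  P 1%g -> (forall g h, P g -> P h -> P (g * h)%g) ->
  (forall g, P g -> P g^-1%g) -> (forall g, S g -> P g) ->
  forall g, generated S g -> P g.
Proof.
by move=> P1 PM PV PS g; elim=> {g} [g /PS|//|g h _ Pg _ Ph|g _ Pg] //; auto.
Qed.

End Order.

Section Structure.
Variable slope : nat -> int.
Local Notation G := (elt slope).
Local Notation ev := (ev slope).
Local Notation reduce := (reduce slope).
Implicit Types g h : G.

Definition pos_of (w : word) j : int := \sum_(a <- take j w) tau a.

Lemma pos_of_cons a w j : pos_of (a :: w) j.+1 = tau a + pos_of w j.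
Proof. by rewrite /pos_of /= big_cons. Qed.

Definition letter0 : letter := (0%N, false).

(** The occurrence at place j of x or its inverse contributes to the exponent
    of x_i, where i is the exponent of t in the first j letters. *)
Lemma func_ev w f :
  func (ev w) f = \sum_(j < size w) eps (nth letter0 w j) * f (pos_of w j).
Proof.
elim: w f => [|a w IH] f; first by rewrite big_ord0.
rewrite /= IH big_ord_recl /pos_of take0 big_nil; congr (_ + _).
by apply: eq_bigr => j _; rewrite /= big_cons addrC.
Qed.

(** Expanding f over the [delta m] with m among the finitely many indices that
    occur shows that the values at the [delta m] determine the linear form. *)
Lemma func_ev_delta w : (forall j, (j < size w)%N -> func (ev w) (delta (pos_of w j)) = 0) ->
  forall f, func (ev w) f = 0.
Proof.
move=> H f; rewrite func_ev.
pose ks := undup [seq pos_of w j | j <- iota 0 (size w)].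
have fE (j : 'I_(size w)) : f (pos_of w j) = \sum_(m <- ks) f m * delta m (pos_of w j).
  rewrite (bigD1_seq (pos_of w j)) ?undup_uniq //=; last first.
    by rewrite mem_undup; apply: map_f; rewrite mem_iota ltn_ord.
  by rewrite /delta eqxx mulr1 big1 ?addr0 // => m /negPf; rewrite eq_sym => ->; rewrite mulr0.
under eq_bigr => j _ do rewrite fE mulr_sumr.
rewrite exchange_big big1_seq //= => m; rewrite mem_undup => /mapP[j].
rewrite mem_iota => /H Hj ->.
transitivity (f (pos_of w j) * func (ev w) (delta (pos_of w j))).
  by rewrite func_ev mulr_sumr; apply: eq_bigr => i _; ring.
by rewrite Hj mulr0.
Qed.

Definition ce g := cent (val_elt g).
Definition fn g := func (val_elt g).
Definition sh g := shift (val_elt g).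

Lemma ceM g h m : ce (g * h)%g m = ce g m + ce h m +
  reduce (fun n => fn g (fun i => fn h (fun j => delta (i + n.+1%:Z) (j + sh g)))) m.
Proof. by rewrite /ce val_mulg. Qed.

Lemma fnM g h f : fn (g * h)%g f = fn g f + fn h (fun j => f (j + sh g)).
Proof. by rewrite /fn val_mulg. Qed.

Lemma shM g h : sh (g * h)%g = sh g + sh h.
Proof. by rewrite /sh val_mulg. Qed.

Lemma fn_zero g : fn g (fun=> 0) = 0.
Proof.
have [w ->] := of_wordP g; rewrite /fn func_ev big1 // => j _.
by rewrite mulr0.
Qed.

Lemma fn_delta g : (forall m, fn g (delta m) = 0) -> forall f, fn g f = 0.
Proof.
by have [w ->] := of_wordP g => H; apply: func_ev_delta => j _; apply: H.
Qed.

(** A lower bound for the support, so that a nonzero function has a first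
    nonzero value. *)
Lemma fn_bounded g : exists b : int, forall m, m < b -> fn g (delta m) = 0.
Proof.
have [w ->] := of_wordP g.
exists (- (size w)%:Z) => m mb; rewrite /fn func_ev big1 // => j _.
suff -> : delta m (pos_of w j) = 0 by rewrite mulr0.
suff : - (size w)%:Z <= pos_of w j by rewrite /delta; case: eqP => // ->; lia.
suff H (u : word) : - (size u)%:Z <= \sum_(a <- u) tau a.
  by apply: le_trans (H _); rewrite lerN2 lez_nat size_take ltn_ord ltnW.
elim: u => [|a u IH]; first by rewrite big_nil.
rewrite big_cons /= -add1n PoszD opprD lerD //.
by rewrite /tau; case: ifP => //; case: ifP.
Qed.

Lemma elt_ext g h : (forall m, ce g m = ce h m) -> (forall f, fn g f = fn h f) ->
  sh g = sh h -> g = h.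
Proof. by move=> *; apply/elt_inj/tripleP. Qed.

Lemma sh1 : sh (1 : G)%g = 0. Proof. by []. Qed.
Lemma fn1 f : fn (1 : G)%g f = 0. Proof. by []. Qed.
Lemma ce1 m : ce (1 : G)%g m = 0. Proof. by []. Qed.

Lemma shV g : sh g^-1%g = - sh g.
Proof. by apply: (addrI (sh g)); rewrite -shM mulgV subrr. Qed.

Definition pos g : Prop :=
  [\/ 0 < sh g,
      sh g = 0 /\ lex_pos (fun m => fn g (delta m))
    | [/\ sh g = 0, forall f, fn g f = 0 & lex_pos (ce g)]].

Lemma pos1 : ~ pos 1%g.
Proof.
by case=> [|[_ [m []]]|[_ _ [m []]]]; rewrite ?sh1 ?fn1 ?ce1 ltxx.
Qed.

Lemma lex_pos_ext d (T : orderType d) (F F' : T -> int) :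
  F =1 F' -> lex_pos F -> lex_pos F'.
Proof. by move/funext->. Qed.

Lemma fnM0 g h f : sh g = 0 -> fn (g * h)%g f = fn g f + fn h f.
Proof.
move=> sg; rewrite fnM sg; congr (_ + fn h _).
by apply/funext => j; rewrite addr0.
Qed.

Lemma ceM_fn0 g h m : (forall f, fn g f = 0) -> ce (g * h)%g m = ce g m + ce h m.
Proof.
move=> g0; rewrite ceM -[RHS]addr0 -[in RHS](reduce0 slope m); congr (_ + reduce _ _).
by apply/funext => n; rewrite g0.
Qed.

Lemma ceM_fn0r g h m : (forall f, fn h f = 0) -> ce (g * h)%g m = ce g m + ce h m.
Proof.
move=> h0; rewrite ceM -[RHS]addr0 -[in RHS](reduce0 slope m); congr (_ + reduce _ _).
apply/funext => n; rewrite -[RHS](fn_zero g); congr fn.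
by apply/funext => i; rewrite h0.
Qed.

Lemma posM g h : pos g -> pos h -> pos (g * h)%g.
Proof.
case=> [sg|[sg Lg]|[sg Lg Cg]] [sh0|[sh0 Lh]|[sh0 Lh Ch]].
- by apply: Or31; rewrite shM addr_gt0.
- by apply: Or31; rewrite shM sh0 addr0.
- by apply: Or31; rewrite shM sh0 addr0.
- by apply: Or31; rewrite shM sg add0r.
- apply: Or32; rewrite shM sg sh0; split=> //.
  by apply: lex_pos_ext (lex_posD Lg Lh) => m; rewrite fnM0.
- apply: Or32; rewrite shM sg sh0; split=> //.
  by apply: lex_pos_ext Lg => m; rewrite fnM0 // Lh addr0.
- by apply: Or31; rewrite shM sg add0r.
- apply: Or32; rewrite shM sg sh0; split=> //.
  by apply: lex_pos_ext Lh => m; rewrite fnM0 // Lg add0r.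
- apply: Or33; rewrite shM sg sh0; split=> // [f|].
    by rewrite fnM0 // Lg Lh.
  by apply: lex_pos_ext (lex_posD Cg Ch) => m; rewrite ceM_fn0.
Qed.

(** Conjugation by k preserves the exponent of t, translates the function f of
    an element with exponent 0, and fixes the central elements. *)
Lemma posJ g (k : G) : pos g -> pos (k^-1 * g * k)%g.
Proof.
set q := (k^-1 * g * k)%g => Hg.
have Ekq : (k * q = g * k)%g by rewrite /q !mulgA mulgV mul1g.
have Esh : sh q = sh g.
  by have := congr1 sh Ekq; rewrite !shM addrC => /addIr.
have Efn : sh g = 0 -> forall f, fn q (fun j => f (j + sh k)) = fn g f.
  move=> sg f; have := congr1 (fun x => fn x f) Ekq.
  by rewrite fnM fnM0 // addrC => /addIr.
case: Hg => [sg|[sg [m [Lm L0]]]|[sg Lg Cg]]; first by apply: Or31; rewrite Esh.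
- apply: Or32; rewrite Esh; split=> //; exists (m - sh k).
  have E i : fn q (delta i) = fn g (delta (i + sh k)).
    rewrite -Efn //; congr fn; apply/funext => j.
    by rewrite delta_shift.
  rewrite E subrK; split=> // i im; rewrite E L0 //.
  by move: im; rewrite ltrBrDr.
- have Lq f : fn q f = 0.
    rewrite -(Lg (fun j => f (j - sh k))) -Efn //; congr fn.
    by apply/funext => j; rewrite addrK.
  apply: Or33; rewrite Esh; split=> //.
  apply: lex_pos_ext Cg => m; have := congr1 (fun x => ce x m) Ekq.
  by rewrite ceM_fn0r // ceM_fn0 // addrC => /addIr ->.
Qed.

Lemma posV g : g <> 1%g -> pos g \/ pos g^-1%g.
Proof.
move=> g1; case: (ltgtP (sh g) 0) => [lt|gt|sg].
- by right; apply: Or31; rewrite shV oppr_gt0.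
- by left; apply: Or31.
have sgV : sh g^-1%g = 0 by rewrite shV sg oppr0.
have fnV f : fn g^-1%g f = - fn g f.
  by apply: (addrI (fn g f)); rewrite -fnM0 // mulgV subrr.
have [Lg|Lg] := pselect (forall m, fn g (delta m) = 0); last first.
  have [b Hb] := fn_bounded g.
  have [H|H] := lex_pos_int Hb Lg; [left | right]; apply: Or32; split=> //.
  by apply: lex_pos_ext H => m; rewrite fnV.
have {}Lg := fn_delta Lg.
have LgV f : fn g^-1%g f = 0 by rewrite fnV Lg oppr0.
have ceV m : ce g^-1%g m = - ce g m.
  by apply: (addrI (ce g m)); rewrite -ceM_fn0 // mulgV subrr.
have [|H|H] := @lex_pos_nat (ce g).
- by move=> Cg; apply: g1; apply: elt_ext => // f.
- by left; apply: Or33; split.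
- by right; apply: Or33; split=> //; apply: lex_pos_ext H => m; rewrite ceV.
Qed.

Lemma elt_bi_orderable : bi_orderable G.
Proof.
exists (fun g h => g = h \/ pos (g^-1 * h)%g).
by apply: bi_order_of_cone; [exact: pos1 | exact: posM | exact: posJ | exact: posV].
Qed.

Lemma fnV0 g f : sh g = 0 -> fn g^-1%g f = - fn g f.
Proof.
by move=> sg; apply: (addrI (fn g f)); rewrite -fnM0 // mulgV subrr.
Qed.

(** * The derived series and the central commutators *)
Lemma derived1 g : derived_subgroup 1 g -> sh g = 0.
Proof.
apply: (generated_ind (P := fun g => sh g = 0)) => {g} [//|g h|g|g].
- by rewrite shM => -> ->.
- by rewrite shV => ->.
- by case=> a [b [_ _ ->]]; rewrite !shM !shV; lia.
Qed.

Lemma derived2 g : derived_subgroup 2 g -> sh g = 0 /\ forall f, fn g f = 0.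
Proof.
apply: (generated_ind (P := fun g => sh g = 0 /\ forall f, fn g f = 0)) => {g}
  [//|g h [sg Lg] [sh0 Lh]|g [sg Lg]|g].
- by rewrite shM sg sh0; split=> // f; rewrite fnM0 // Lg Lh.
- by rewrite shV sg; split=> // f; rewrite fnV0 // Lg.
- case=> a [b [/derived1 sa /derived1 sb ->]]; split.
    by rewrite !shM !shV; lia.
  by move=> f; rewrite !fnM0 ?shV ?sa ?sb ?oppr0 // !fnV0 //; lia.
Qed.

Lemma derived3 g : derived_subgroup 3 g -> g = 1%g.
Proof.
apply: (generated_ind (P := fun g => g = 1%g)) => {g} [//|g h -> ->|g ->|g].
- by rewrite mulg1.
- by rewrite invg1.
- case=> a [b [/derived2[sa La] /derived2[sb Lb] ->]].
  apply/eqP/commgP; apply: elt_ext => [m|f|].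
  + by rewrite !ceM_fn0 // addrC.
  + by rewrite !fnM0 // addrC.
  + by rewrite !shM addrC.
Qed.

Definition xconj m : G := (gen slope 0 ^+ m * gen slope 1 * (gen slope 0)^-1 ^+ m)%g.

Lemma xconjS m : (gen slope 0 * xconj m * (gen slope 0)^-1 = xconj m.+1)%g.
Proof. by rewrite /xconj expgS expgSr !mulgA. Qed.

Lemma sh_xconj m : sh (xconj m) = 0.
Proof.
elim: m => [|m IH]; first by rewrite /xconj !expg0 mulg1 mul1g.
by rewrite -xconjS 2!shM IH shV; lia.
Qed.

Lemma fn_xconj m f : fn (xconj m) f = f m%:Z.
Proof.
elim: m f => [|m IH] f.
  by rewrite /xconj !expg0 mulg1 mul1g /fn /= /eps /= mul1r addr0.
have fn_t k : fn (gen slope 0) k = 0 by rewrite /fn /= mul0r.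
have := congr1 (fun g => fn g f) (xconjS m).
rewrite 2!fnM IH fn_t add0r => <-.
have -> : forall k, fn (gen slope 0)^-1%g k = 0 by move=> k; rewrite of_word_inv /fn /= mul0r.
by rewrite addr0; congr f; rewrite /sh /= /tau /=; lia.
Qed.

Lemma ce_xconj m k : ce (xconj m) k = 0.
Proof.
elim: m k => [|m IH] k.
  by rewrite /xconj !expg0 mulg1 mul1g /ce /= reduce0 mulr0.
have fn_t f : fn (gen slope 0) f = 0 by rewrite /fn /= mul0r.
have fn_ti f : fn (gen slope 0)^-1%g f = 0 by rewrite of_word_inv /fn /= mul0r.
rewrite -xconjS ceM_fn0r // ceM_fn0 // IH of_word_inv /ce /=.
by rewrite reduce0 !mul0r.
Qed.

Lemma ce_xconjM i j k : ce (xconj i * xconj j)%g k =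
  reduce (fun n => delta (i%:Z + n.+1%:Z) j%:Z) k.
Proof.
rewrite ceM !ce_xconj !add0r; congr reduce; apply/funext => n.
by rewrite sh_xconj !fn_xconj addr0.
Qed.

(** The commutator z_m of x_0 and x_m.  For m > 0 it is the basis vector of index
    m - 1 of the central part, up to [reduce]. *)
Definition xcomm m : G := (xconj 0 * xconj m * (xconj 0)^-1 * (xconj m)^-1)%g.

Lemma xcommE m : (xcomm m * (xconj m * xconj 0) = xconj 0 * xconj m)%g.
Proof. by rewrite /xcomm; move: (xconj m) (xconj 0) => a b; rewrite !mulgA !mulgVK. Qed.

Lemma sh_xcomm m : sh (xcomm m) = 0.
Proof. by rewrite 3!shM !shV !sh_xconj. Qed.

Lemma fn_xcomm m f : fn (xcomm m) f = 0.
Proof.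
rewrite /xcomm; move: (sh_xconj m) (sh_xconj 0).
move: (xconj m) (xconj 0) => a b sa sb.
by rewrite !fnM0 ?shM ?shV ?sa ?sb ?oppr0 // !fnV0 //; lia.
Qed.

Lemma ce_xcomm m k : ce (xcomm m) k = reduce (fun n => delta n.+1%:Z m%:Z) k.
Proof.
have := congr1 (fun g => ce g k) (xcommE m).
rewrite ceM_fn0; last by apply: fn_xcomm.
rewrite !ce_xconjM.
have -> : (fun n : nat => delta (0%:Z + n.+1%:Z) m%:Z) =
    (fun n => delta n.+1%:Z m%:Z) by apply/funext => n; rewrite add0r.
move=> <-; rewrite -[LHS]addr0; congr (_ + _).
rewrite -[LHS](reduce0 slope k); congr reduce; apply/funext => n.
by rewrite /delta; case: eqP => //; lia.
Qed.

Definition acomm n := xcomm n.*2.+1.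
Definition ccomm n := xcomm n.*2.+2.

Lemma ce_ccomm n k : ce (ccomm n) k = (k == n.*2.+1)%:R.
Proof.
rewrite ce_xcomm /reduce /delta; case Ek: (odd k); last first.
  by case: eqP; case: eqP; rewrite ?mulr0 ?mulr1 //; lia.
have -> : (n.*2.+2%:Z == k.-1.+1%:Z) = false by apply/eqP; lia.
by rewrite mulr0 addr0; congr (nat_of_bool _)%:R; apply/eqP/eqP; lia.
Qed.

Lemma ce_acomm n k : slope n != 0 -> ce (acomm n) k = slope n * ce (ccomm n) k.
Proof.
move=> sn; rewrite ce_ccomm ce_xcomm /reduce /delta; case Ek: (odd k).
  have -> : (n.*2.+1%:Z == k.+1%:Z) = false by apply/eqP; lia.
  case: (k =P n.*2.+1) => [->|ne].
    by rewrite /= eqxx uphalf_double add0r.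
  have -> : (n.*2.+1%:Z == k.-1.+1%:Z) = false by apply/eqP; lia.
  by rewrite !mulr0.
have -> : (k == n.*2.+1) = false by apply/eqP; lia.
transitivity (0 : int); last by rewrite mulr0.
case: (n.*2.+1%:Z =P k.+1%:Z) => [E|_]; last by rewrite mulr0.
have -> : k./2 = n by lia.
by rewrite (negPf sn); apply: mul0r.
Qed.

Lemma ccomm_neq1 n : ccomm n <> 1%g.
Proof. by move/(congr1 (fun g => ce g n.*2.+1)); rewrite ce_ccomm eqxx. Qed.

Lemma ce_expg g k m : (forall f, fn g f = 0) -> ce (g ^+ m)%g k = m%:Z * ce g k.
Proof.
move=> g0; elim: m => [|m IH]; first by rewrite expg0 mul0r.
by rewrite expgS ceM_fn0 // IH; lia.
Qed.

Lemma central_expg g m : sh g = 0 -> (forall f, fn g f = 0) ->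
  sh (g ^+ m)%g = 0 /\ forall f, fn (g ^+ m)%g f = 0.
Proof.
move=> sg g0; elim: m => [//|m [sm Lm]]; rewrite expgS shM sg sm.
by split=> // f; rewrite fnM0 // g0 Lm.
Qed.

Lemma acomm_pos n m : slope n = m.+1%:Z -> acomm n = (ccomm n ^+ m.+1)%g.
Proof.
move=> Es; have fC := fn_xcomm n.*2.+2; have fA := fn_xcomm n.*2.+1.
have [sC LC] := central_expg m.+1 (sh_xcomm n.*2.+2) fC.
apply: elt_ext => [k|f|].
- by rewrite ce_acomm ?Es // (ce_expg _ _ fC).
- by rewrite fA LC.
- by rewrite sC; apply: sh_xcomm.
Qed.

Lemma acomm_neg n m : slope n = - m.+1%:Z -> acomm n = (ccomm n ^+ m.+1)^-1%g.
Proof.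
move=> Es; have fC := fn_xcomm n.*2.+2; have fA := fn_xcomm n.*2.+1.
have [sC LC] := central_expg m.+1 (sh_xcomm n.*2.+2) fC.
apply: (mulIg (ccomm n ^+ m.+1)%g); rewrite mulVg.
have sA : sh (acomm n) = 0 by apply: sh_xcomm.
apply: elt_ext => [k|f|].
- by rewrite (ceM_fn0 _ _ fA) ce_acomm ?Es // (ce_expg _ _ fC) mulNr addNr.
- by rewrite (fnM0 _ _ sA) fA LC.
- by rewrite shM sA sC.
Qed.

(** For a and b with exponent 0 in t, the central parts of a b and b a differ
    only by the corrections. *)
Lemma reduce_commute (a b : G) m : sh a = 0 -> sh b = 0 -> commute a b ->
  reduce (fun n => fn a (fun i => fn b (delta (i + n.+1%:Z)))) m =
  reduce (fun n => fn b (fun i => fn a (delta (i + n.+1%:Z)))) m.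
Proof.
have E (c : G) (k : int) : (fun j => delta k (j + 0)) = delta k.
  by apply/funext => j; rewrite addr0.
move=> sa sb /(congr1 (fun g => ce g m)); rewrite !ceM sa sb.
rewrite [ce b m + _]addrC => /addrI.
under eq_fun => n do under eq_fun => i do rewrite (E a).
under [in X in _ = X -> _]eq_fun => n do under eq_fun => i do rewrite (E a).
by [].
Qed.

(** With u_m = x_(m+1) x_m^-1, the commutator of u_0 and u_1 is z_1^2 z_2^-1.
    Since z_1 = a_0 and z_2 = c_0, its coordinate on c_0 is the odd number
    2 * slope 0 - 1. *)
Lemma derived2_nontrivial : ~ forall g, derived_subgroup 2 g -> g = 1%g.
Proof.
move=> H.
pose u m := (xconj m.+1 * (xconj m)^-1)%g.
have uE m : u m = [~ (gen slope 0)^-1, (xconj m)^-1]%g.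
  rewrite /u -xconjS /commg /conjg; move: (xconj m) => a; by rewrite !invgK !mulgA.
have u1 m : derived_subgroup 1 (u m).
  by apply: generated_mem; exists (gen slope 0)^-1%g, (xconj m)^-1%g; split.
have /eqP/commgP Euv : [~ u 0%N, u 1%N]%g = 1%g.
  apply: H; apply: generated_mem; exists (u 0%N), (u 1%N).
  by split=> //; apply: u1.
have fn_u m f : fn (u m) f = f m.+1%:Z - f m%:Z.
  by rewrite /u fnM0 ?sh_xconj // fnV0 ?sh_xconj // !fn_xconj.
have sh_u m : sh (u m) = 0 by rewrite /u shM shV !sh_xconj.
have := @reduce_commute (u 0%N) (u 1%N) 1 (sh_u _) (sh_u _) Euv.
rewrite /reduce /= !fn_u /delta /=; lia.
Qed.

Lemma elt_derived_length : solvable_of_derived_length G 3.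
Proof.
split=> [|m m3 Hm]; first exact: derived3.
apply: derived2_nontrivial => g.
have H n : derived_subgroup (n + m) g -> g = 1%g.
  elim: n g => [|n IH] g; first exact: Hm.
  apply: (generated_ind (P := fun g => g = 1%g)) => {g} [//|g h -> ->|g ->|g].
  - by rewrite mulg1.
  - by rewrite invg1.
  - by case=> a [b [/IH -> _ ->]]; rewrite comm1g.
by rewrite -(subnK (m3 : m <= 2)%N); apply: H.
Qed.

End Structure.
(** * The word problem *)

Section WordProblem.
Variable slope : nat -> int.
Local Notation ev := (ev slope).
Local Notation reduce := (reduce slope).

Definition eps_of (w : word) j : int := eps (nth letter0 w j).

(** The central part of a word before [reduce]: two occurrences of x or x^-1, at
    places j < l where the exponents of t are i and i + n + 1, contribute the
    product of their signs to z_(n+1). *)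
Definition zeta (w : word) (n : nat) : int :=
  \sum_(j < size w) \sum_(l < size w) (j < l)%:R *
    (eps_of w j * eps_of w l * delta n.+1%:Z (pos_of w l - pos_of w j)).

Lemma zeta_cons a w n : zeta (a :: w) n = zeta w n +
  eps a * func (ev w) (fun i => delta n.+1%:Z (i + tau a)).
Proof.
rewrite /zeta /= big_ord_recl [LHS]addrC; congr (_ + _).
  apply: eq_bigr => j _; rewrite big_ord_recl /= mul0r add0r.
  apply: eq_bigr => l _; rewrite /= !pos_of_cons /bump !add1n ltnS.
  by congr (_ * (_ * delta _ _)); ring.
rewrite big_ord_recl /= mul0r add0r func_ev mulr_sumr.
apply: eq_bigr => l _; rewrite /= !pos_of_cons /bump add1n /= mul1r mulrA.
by congr (_ * delta _ _); rewrite /pos_of take0 big_nil; ring.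
Qed.

Lemma cent_ev w m : cent (ev w) m = reduce (zeta w) m.
Proof.
elim: w => [|a w IH] /=.
  rewrite (_ : zeta [::] = fun=> 0) ?reduce0 //.
  by apply/funext => n; rewrite /zeta big_ord0.
rewrite IH -reduceM -reduceD; congr reduce.
by apply/funext => n; rewrite zeta_cons.
Qed.

Lemma shift_ev w : shift (ev w) = pos_of w (size w).
Proof.
rewrite /pos_of take_size; elim: w => [|a w IH] /=; first by rewrite big_nil.
by rewrite big_cons IH.
Qed.

Lemma of_word_eq1 w : of_word slope w = 1%g <->
  [/\ pos_of w (size w) = 0,
      forall j, (j < size w)%N ->
        \sum_(i < size w) eps_of w i * delta (pos_of w j) (pos_of w i) = 0
    & forall m, reduce (zeta w) m = 0].
Proof.
split=> [E|[Es Ef Ec]].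
  have {}E : ev w = triple1 by move: (congr1 (@val_elt slope) E).
  split=> [|j _|m]; first by rewrite -(shift_ev) E.
    by rewrite -(func_ev slope) E.
  by rewrite -cent_ev E.
apply/elt_inj/tripleP => [m|f|].
- by rewrite [LHS]cent_ev Ec.
- by rewrite [LHS]func_ev_delta // => j jw; rewrite func_ev; apply: Ef.
- by rewrite [LHS]shift_ev Es.
Qed.

Lemma tau_bound a : `|tau a| <= 1.
Proof. by rewrite /tau; case: ifP => //; case: ifP. Qed.

Lemma pos_of_bound w j l : (j < l <= size w)%N ->
  `|pos_of w l - pos_of w j| <= (size w)%:Z.
Proof.
case/andP=> jl lw; rewrite /pos_of -(cat_take_drop j (take l w)).
rewrite take_takel ?(ltnW jl) // big_cat /= addrAC subrr add0r.
apply: (@le_trans _ _ (size (drop j (take l w)))%:Z); last first.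
  by rewrite lez_nat size_drop size_takel // (leq_trans (leq_subr _ _)).
elim: (drop _ _) => [|a u IH]; first by rewrite big_nil.
rewrite big_cons /= -add1n PoszD (le_trans (ler_normD _ _)) //.
exact: lerD (tau_bound a) IH.
Qed.

(** The search for a nonzero coordinate can be bounded by the length, because
    exponents of t in the prefixes of w differ by at most that. *)
Lemma zeta_out w n : (size w <= n)%N -> zeta w n = 0.
Proof.
move=> wn; rewrite /zeta big1 // => j _; rewrite big1 // => l _.
have [jl|] := ltnP j l; last by rewrite mul0r.
have := @pos_of_bound w j l; rewrite jl (ltnW (ltn_ord l)) => /(_ isT) H.
rewrite /delta; case: eqP => [E|]; last by rewrite !mulr0.
by move: H; rewrite E; lia.
Qed.

Lemma reduce_pairs (z : nat -> int) :
  (forall m, reduce z m = 0) <->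
  forall n, (slope n == 0)%:R * z n.*2 = 0 /\ z n.*2.+1 + slope n * z n.*2 = 0.
Proof.
split=> [H n|H m].
  split; first by have := H n.*2; rewrite /reduce odd_double doubleK.
  by have := H n.*2.+1; rewrite /reduce /= odd_double uphalf_double.
rewrite /reduce; case Em: (odd m).
  have [_] := H m./2; rewrite (_ : m./2.*2.+1 = m); last by lia.
  by rewrite (_ : m./2.*2 = m.-1) //; lia.
by have [] := H m./2; rewrite (_ : m./2.*2 = m) //; lia.
Qed.

End WordProblem.

Local Open Scope nat_scope.

Local Arguments word_code : simpl never.
Local Arguments cnth : simpl never.

Definition lcode (a : letter) : nat := (a.1.*2 + a.2)%N.

Lemma cnth_word w j : cnth (word_code w) j = lcode (nth letter0 w j).
Proof.
rewrite /word_code cnth_code; have [jw|wj] := ltnP j (size w).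
  by rewrite (nth_map letter0).
by rewrite !nth_default ?size_map.
Qed.

Definition csize u := bsum u (fun i => iter i ctail u != 0%N).

Lemma csize_word w : csize (word_code w) = size w.
Proof.
set v := [seq lcode a | a <- w]; rewrite -[RHS](size_map lcode) -/v.
have le_v : (size v <= code v)%N.
  by elim: (v) => // n s IH; rewrite -ccons_code /ccons /=;
     apply: leq_trans (leq_pmull _ _); rewrite ?expn_gt0 //; lia.
rewrite /csize bsumE -/(code v) -[RHS](sum_ltn le_v); apply: eq_bigr => i _.
rewrite iter_ctail_code; have [iv|vi] := ltnP i (size v).
  by rewrite (drop_nth 0%N iv) -ccons_code ccons_eq0.
by rewrite drop_oversize.
Qed.

Lemma rec_csize k F : recursive k F -> recursive k (fun v => csize (F v)).
Proof.
apply: rec_app1; rewrite /csize; rec_tac.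
by apply: (rec_iter (B := fun u _ => ctail u)); rec_tac.
Qed.

(** Integers are replaced by natural numbers: the exponent of t after j letters
    is [cpos u j - j], since each letter contributes its exponent of t plus 1. *)
Definition weight c : nat := if c == 0%N then 2 else if c == 1%N then 0 else 1.
Definition cpos u j : nat := bsum j (fun i => weight (cnth u i)).
Definition cplus u j : bool := cnth u j == 2.
Definition cminus u j : bool := cnth u j == 3.

Definition csame u j l : bool :=
  (cplus u j && cplus u l) || (cminus u j && cminus u l).
Definition copp u j l : bool :=
  (cplus u j && cminus u l) || (cminus u j && cplus u l).
Definition cdist u n j l : bool := cpos u l + j == cpos u j + l + n.

Definition zplus u n : nat := bsum (csize u) (fun j => bsum (csize u) (fun l =>
  [&& j < l, csame u j l & cdist u n.+1 j l]%N)).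
Definition zminus u n : nat := bsum (csize u) (fun j => bsum (csize u) (fun l =>
  [&& j < l, copp u j l & cdist u n.+1 j l]%N)).

Definition total_shift_ok u : bool := cpos u (csize u) == csize u.
Definition letters_ok u : bool := bforall (csize u) (fun j => cnth u j < 4).
Definition func_ok u : bool := bforall (csize u) (fun j =>
  bsum (csize u) (fun i => cplus u i && (cpos u i + j == cpos u j + i)) ==
  bsum (csize u) (fun i => cminus u i && (cpos u i + j == cpos u j + i))).

Section Decision.
Variable slope : nat -> int.
Variables slope_pos slope_neg : nat -> nat -> bool.
Hypothesis slope_posE : forall n s, slope_pos n s -> slope n = s.+1%:Z.
Hypothesis slope_negE : forall n s, slope_neg n s -> slope n = (- s.+1%:Z)%R.
Hypothesis slope_cases : forall n,
  slope n = 0 \/ exists s, slope_pos n s || slope_neg n s.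

(** Put p = ap - an and q = cp - cn.  The slope is not computable, but a slope of
    absolute value s + 1 matters for the vanishing of p a_n + q c_n only if
    s < |q|, which is at most cp + cn. *)
Definition pair_ok (ap an cp cn n : nat) : bool :=
  ((ap == an) && (cp == cn)) || bexists (cp + cn) (fun s =>
    (slope_pos n s && (cp + s.+1 * ap == cn + s.+1 * an)) ||
    (slope_neg n s && (cp + s.+1 * an == cn + s.+1 * ap))).

Lemma pair_okP ap an cp cn n : pair_ok ap an cp cn n <->
  (((slope n == 0) : nat)%:R * (ap%:Z - an%:Z) = 0 /\
   (cp%:Z - cn%:Z) + slope n * (ap%:Z - an%:Z) = 0)%R.
Proof.
split.
  case/orP=> [/andP[/eqP-> /eqP->]|/bexistsP[s _ /orP[]/andP[]]].
  - by rewrite !subrr !mulr0.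
  - move=> /slope_posE-> /eqP E; split; first exact: mul0r.
    by move: E; rewrite -!(mulnC (ap)) -!(mulnC an); nia.
  - move=> /slope_negE-> /eqP E; split; first exact: mul0r.
    by move: E; nia.
case=> E1 E2; rewrite /pair_ok; case: (ap =P an) => [Ea|Na] /=.
  by move: E2; rewrite Ea subrr mulr0 addr0 => E2; rewrite (_ : cp == cn) //; lia.
have [s0|[s Hs]] := slope_cases n.
  by move: E1; rewrite s0 eqxx mul1r; lia.
apply/bexistsP; exists s; case/orP: Hs => Hs; rewrite ?Hs /=.
- by move: E2; rewrite (slope_posE Hs) => E2; nia.
- by move: E2; rewrite (slope_negE Hs) => E2; nia.
- by move: E2; rewrite (slope_posE Hs) => E2; apply/orP; left; apply/eqP; nia.
- by move: E2; rewrite (slope_negE Hs) => E2; apply/orP; right; apply/eqP; nia.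
Qed.

Definition cent_ok u : bool := bforall (csize u) (fun n =>
  pair_ok (zplus u n.*2) (zminus u n.*2) (zplus u n.*2.+1) (zminus u n.*2.+1) n).

Definition trivial_code u : bool :=
  [&& letters_ok u, total_shift_ok u, func_ok u & cent_ok u].

Lemma letters_okP w : letters_ok (word_code w) = is_word (Some 2) w.
Proof.
apply/bforallP/allP => [H [i b] /(nthP letter0)[j jw E]|H j].
  have := H j; rewrite csize_word cnth_word E => /(_ jw).
  by rewrite /lcode /=; case: b {E}; lia.
rewrite csize_word => jw; rewrite cnth_word; have := H _ (mem_nth letter0 jw).
by case: (nth _ _ _) => i []; rewrite /lcode /=; lia.
Qed.

Section Letters.
Variable w : word.
Hypothesis w_ok : is_word (Some 2) w.
Local Notation u := (word_code w).

Lemma letter_lt2 j : (nth letter0 w j).1 < 2.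
Proof.
have [jw|wj] := ltnP j (size w); last by rewrite nth_default.
by move/allP: w_ok => /(_ _ (mem_nth letter0 jw)).
Qed.

Lemma epsE j : (eps_of w j = (cplus u j : nat)%:Z - (cminus u j : nat)%:Z)%R.
Proof.
rewrite /eps_of /cplus /cminus cnth_word /eps /lcode.
by have := letter_lt2 j; case: (nth _ _ _) => [[|[|i]] []].
Qed.

Lemma cposE j : j <= size w -> (pos_of w j = (cpos u j)%:Z - j%:Z)%R.
Proof.
rewrite /cpos bsumE; elim: j => [_|j IH jw].
  by rewrite /pos_of take0 big_nil big_ord0.
rewrite /pos_of (take_nth letter0) // -cats1 big_cat big_seq1 -/(pos_of w j).
rewrite (IH (ltnW jw)) big_ord_recr [nat_of_ord ord_max]/= cnth_word PoszD.
rewrite /tau /weight /lcode.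
by have := letter_lt2 j; case: (nth _ _ _) => [[|[|i]] []] //= _; lia.
Qed.

Lemma bsum_int n (f : nat -> nat) : ((bsum n f)%:Z = \sum_(i < n) (f i)%:Z)%R.
Proof. by rewrite bsumE (big_morph _ PoszD (erefl 0%:Z)). Qed.

Lemma zetaE n : (zeta w n = (zplus u n)%:Z - (zminus u n)%:Z)%R.
Proof.
rewrite /zplus /zminus !bsum_int csize_word -sumrB; apply: eq_bigr => j _.
rewrite !bsum_int -sumrB; apply: eq_bigr => l _.
rewrite !epsE !cposE ?(ltnW (ltn_ord _)) // /csame /copp /cdist /delta.
rewrite (_ : (_ == n.+1%:Z)%R = (cpos u l + j == cpos u j + l + n.+1)); last by apply/eqP/eqP; lia.
have : ~~ (cplus u j && cminus u j) by rewrite /cplus /cminus; case: eqP => // ->.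
have : ~~ (cplus u l && cminus u l) by rewrite /cplus /cminus; case: eqP => // ->.
by case: (j < l); case: (cplus u j); case: (cminus u j); case: (cplus u l);
  case: (cminus u l); case: (_ == _).
Qed.

Lemma funcE j : j < size w ->
  (\sum_(i < size w) eps_of w i * delta (pos_of w j) (pos_of w i) =
   (bsum (csize u) (fun i => cplus u i && (cpos u i + j == cpos u j + i)))%:Z -
   (bsum (csize u) (fun i => cminus u i && (cpos u i + j == cpos u j + i)))%:Z)%R.
Proof.
move=> jw; rewrite !bsum_int csize_word -sumrB; apply: eq_bigr => i _.
rewrite epsE !cposE ?(ltnW (ltn_ord _)) ?(ltnW jw) // /delta.
rewrite (_ : ((_ - _)%R == _) = (cpos u i + j == cpos u j + i)); last by apply/eqP/eqP; lia.
by case: (cplus u i); case: (cminus u i); case: (_ == _).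
Qed.

Lemma trivial_codeP_ok : trivial_code u <-> of_word slope w = 1%g.
Proof.
rewrite /trivial_code letters_okP w_ok /=; split.
  case/and3P=> /eqP Es /bforallP Ef /bforallP Ec.
  apply/of_word_eq1; split; last apply/reduce_pairs.
  - by rewrite cposE // -{1}csize_word Es csize_word subrr.
  - by move=> j jw; rewrite funcE // (eqP (Ef j _)) ?csize_word // subrr.
  - move=> n; have [nw|wn] := ltnP n (size w).
      by rewrite !zetaE; apply/pair_okP/Ec; rewrite csize_word.
    by rewrite !zeta_out ?mulr0 ?addr0 //; lia.
case/of_word_eq1=> Es Ef /reduce_pairs Ec; apply/and3P; split.
- by move: Es; rewrite cposE // /total_shift_ok csize_word; lia.
- apply/bforallP => j; rewrite csize_word => jw.
  by have := Ef j jw; rewrite funcE // csize_word => /subr0_eq[->].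
- apply/bforallP => n _; apply/pair_okP; have := Ec n.
  by rewrite !zetaE.
Qed.
End Letters.

Lemma trivial_codeP w :
  trivial_code (word_code w) <-> is_word (Some 2) w /\ of_word slope w = 1%g.
Proof.
split=> [H|[H1 H2]]; last exact/trivial_codeP_ok.
have w_ok : is_word (Some 2) w by rewrite -letters_okP; case/and4P: H.
by split=> //; apply/trivial_codeP_ok.
Qed.

Hypothesis rec_slope_pos :
  recursive 2 (fun v => nat_of_bool (slope_pos (nth 0 v 0) (nth 0 v 1))).
Hypothesis rec_slope_neg :
  recursive 2 (fun v => nat_of_bool (slope_neg (nth 0 v 0) (nth 0 v 1))).

Lemma rec_slope_pos_comp k F H : recursive k F -> recursive k H ->
  recursive k (fun v => nat_of_bool (slope_pos (F v) (H v))).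
Proof. exact: (rec_app2 (f := fun n s => slope_pos n s)) rec_slope_pos. Qed.

Lemma rec_slope_neg_comp k F H : recursive k F -> recursive k H ->
  recursive k (fun v => nat_of_bool (slope_neg (F v) (H v))).
Proof. exact: (rec_app2 (f := fun n s => slope_neg n s)) rec_slope_neg. Qed.

Lemma rec_cpos k F H : recursive k F -> recursive k H ->
  recursive k (fun v => cpos (F v) (H v)).
Proof. by apply: rec_app2; rewrite /cpos /weight; rec_tac. Qed.

Ltac rec_more ::= first [ simple apply rec_chead | simple apply rec_ctail
  | simple apply rec_ccons | simple apply rec_cnth | simple apply rec_fact
  | simple apply rec_csize | simple apply rec_cpos
  | simple apply rec_slope_pos_comp | simple apply rec_slope_neg_comp ].

Lemma rec_zplus k F H : recursive k F -> recursive k H ->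
  recursive k (fun v => zplus (F v) (H v)).
Proof.
apply: rec_app2.
by rewrite /zplus /csame /cdist /cplus /cminus; rec_tac.
Qed.

Lemma rec_zminus k F H : recursive k F -> recursive k H ->
  recursive k (fun v => zminus (F v) (H v)).
Proof.
apply: rec_app2.
by rewrite /zminus /copp /cdist /cplus /cminus; rec_tac.
Qed.

Ltac rec_more ::= first [ simple apply rec_chead | simple apply rec_ctail
  | simple apply rec_ccons | simple apply rec_cnth | simple apply rec_fact
  | simple apply rec_csize | simple apply rec_cpos
  | simple apply rec_zplus | simple apply rec_zminus
  | simple apply rec_slope_pos_comp | simple apply rec_slope_neg_comp ].

Lemma rec_trivial_code :
  recursive 1 (fun v => nat_of_bool (trivial_code (nth 0 v 0))).
Proof.
rewrite /trivial_code /letters_ok /total_shift_ok /func_ok /cent_ok /pair_ok.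
rewrite /cplus /cminus.
rec_tac.
Qed.

Lemma elt_computable : computable_group (elt slope).
Proof.
exists (Some 2), (gen slope); split; first exact: generating_gen.
have [c Hc] := rec_trivial_code; exists c => w.
have := Hc [:: word_code w] erefl; rewrite [nth _ _ _]/= => Hw.
have [H1 H2] := trivial_codeP w.
rewrite word_value_gen; split=> [/H2 E|nE]; first by rewrite E in Hw.
by case E: (trivial_code _) Hw => // _; case: nE; apply: H1.
Qed.

End Decision.
(** * Diagonalization *)

Definition halts n s : bool := certifies n s 0 || certifies n s 1.
Definition first_halt n s : bool :=
  halts n s && bforall s (fun r => ~~ halts n r).
Definition diag_pos n s : bool := first_halt n s && certifies n s 0.
Definition diag_neg n s : bool := first_halt n s && ~~ certifies n s 0.

Definition diag_slope (n : nat) : int :=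
  if pselect (exists s, first_halt n s) is left H then
    (if certifies n (xchoose H) 0 then (xchoose H).+1%:Z
     else - (xchoose H).+1%:Z)%R
  else 0%R.

Lemma first_halt_unique n s r : first_halt n s -> first_halt n r -> s = r.
Proof.
case/andP=> Hs /bforallP Hs' /andP[Hr /bforallP Hr'].
by case: (ltngtP s r) => // [/Hr'|/Hs']; rewrite ?Hs ?Hr.
Qed.

Lemma diag_slopeE n s : first_halt n s ->
  diag_slope n = (if certifies n s 0 then s.+1%:Z else - s.+1%:Z)%R.
Proof.
rewrite /diag_slope => Hs; case: pselect => [H|[]]; last by exists s.
by rewrite -(first_halt_unique Hs (xchooseP H)).
Qed.

Lemma diag_posE n s : diag_pos n s -> diag_slope n = s.+1%:Z.
Proof. by case/andP=> /diag_slopeE-> ->. Qed.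

Lemma diag_negE n s : diag_neg n s -> diag_slope n = (- s.+1%:Z)%R.
Proof. by case/andP=> /diag_slopeE-> /negPf->. Qed.

Lemma diag_slope_cases n :
  diag_slope n = 0 \/ exists s, diag_pos n s || diag_neg n s.
Proof.
have [[s Hs]|H] := pselect (exists s, first_halt n s).
  by right; exists s; rewrite /diag_pos /diag_neg Hs; case: certifies.
by left; rewrite /diag_slope; case: pselect.
Qed.

Lemma rec_halts k F H : recursive k F -> recursive k H ->
  recursive k (fun v => nat_of_bool (halts (F v) (H v))).
Proof.
by move=> HF HH; rewrite /halts; rec_tac; apply: rec_certifies; rec_tac.
Qed.

Lemma rec_first_halt k F H : recursive k F -> recursive k H ->
  recursive k (fun v => nat_of_bool (first_halt (F v) (H v))).
Proof.
apply: (rec_app2 (f := fun n s => nat_of_bool (first_halt n s))).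
by rewrite /first_halt; rec_tac; apply: rec_halts; rec_tac.
Qed.

Lemma rec_diag_pos :
  recursive 2 (fun v => nat_of_bool (diag_pos (nth 0 v 0) (nth 0 v 1))).
Proof.
rewrite /diag_pos; rec_tac; first by apply: rec_first_halt; rec_tac.
by apply: rec_certifies; rec_tac.
Qed.

Lemma rec_diag_neg :
  recursive 2 (fun v => nat_of_bool (diag_neg (nth 0 v 0) (nth 0 v 1))).
Proof.
rewrite /diag_neg; rec_tac; first by apply: rec_first_halt; rec_tac.
by apply: rec_certifies; rec_tac.
Qed.

Local Open Scope group_scope.

Section Words.
Variables (G : groupType) (N : option nat) (x : nat -> G).

Lemma word_value_cat u v : word_value x (u ++ v) = word_value x u * word_value x v.
Proof. by rewrite /word_value big_cat. Qed.

Lemma word_value_winv w : word_value x (winv w) = (word_value x w)^-1.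
Proof.
elim: w => [|[i b] w IH]; first by rewrite /word_value big_nil invg1.
rewrite /winv /= rev_cons -cats1 word_value_cat IH /word_value big_seq1 big_cons.
by rewrite invgM; case: b; rewrite //= invgK.
Qed.

Lemma is_word_winv w : is_word N (winv w) = is_word N w.
Proof. by rewrite /is_word /winv all_rev all_map. Qed.

Lemma is_word_cat u v : is_word N u -> is_word N v -> is_word N (u ++ v).
Proof. by move=> Hu Hv; rewrite /is_word all_cat; apply/andP. Qed.

Lemma generating_word : generating N x ->
  forall g, exists2 w, is_word N w & word_value x w = g.
Proof.
move=> gen_x g; move: (gen_x g).
apply: (generated_ind (P := fun g => exists2 w, is_word N w & word_value x w = g)).
- by exists [::] => //; rewrite /word_value big_nil.
- move=> a b [u Hu <-] [v Hv <-]; exists (u ++ v).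
    exact: is_word_cat.
  exact: word_value_cat.
- by move=> a [u Hu <-]; exists (winv u); rewrite ?is_word_winv ?word_value_winv.
- move=> a [i iN ->]; exists [:: (i, false)]; first by rewrite /is_word /= iN.
  by rewrite /word_value big_seq1.
Qed.

Definition prepend (w : word) (u : nat) : nat :=
  foldr (fun a => ccons (lcode a)) u w.

Lemma prependE w v : prepend w (word_code v) = word_code (w ++ v).
Proof. by elim: w => //= a w ->. Qed.

Lemma rec_prepend k w F : recursive k F -> recursive k (fun v => prepend w (F v)).
Proof. by move=> HF; elim: w => [//|a w IH] /=; rec_tac. Qed.

Lemma rec_prepend_iter k w N' F : recursive k N' -> recursive k F ->
  recursive k (fun v => iter (N' v) (prepend w) (F v)).
Proof.
move=> HN HF; apply: (rec_iter (B := fun u _ => prepend w u)) => //.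
exact/rec_prepend/rec_nth.
Qed.

Lemma prepend_iter w m v :
  iter m (prepend w) (word_code v) = word_code (iter m (cat w) v).
Proof. by elim: m => //= m ->; rewrite prependE. Qed.

Lemma word_value_iter w m v :
  word_value x (iter m (cat w) v) = word_value x w ^+ m * word_value x v.
Proof.
elim: m => [|m IH]; first by rewrite expg0 mul1g.
by rewrite /= word_value_cat IH expgS mulgA.
Qed.

Lemma is_word_iter w m v : is_word N w -> is_word N v ->
  is_word N (iter m (cat w) v).
Proof.
by move=> Hw Hv; elim: m => //= m IH; apply: is_word_cat.
Qed.

Section Signs.
Variable le : G -> G -> Prop.
Hypothesis order_le : bi_order le.

Lemma le1_expg c m : le 1 c -> le 1 (c ^+ m).
Proof.
case: order_le => refl anti trans total mull mulr Hc.
elim: m => [|m IH]; first by rewrite expg0.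
by rewrite expgS; apply: trans Hc _; rewrite -{1}(mulg1 c); apply: mull.
Qed.

Lemma expg_le1 c m : le c 1 -> le (c ^+ m) 1.
Proof.
case: order_le => refl anti trans total mull mulr Hc.
elim: m => [|m IH]; first by rewrite expg0.
by rewrite expgS; apply: trans Hc; rewrite -{3}(mulg1 c); apply: mull.
Qed.

Lemma sign_expg c m : c <> 1 -> le 1 (c ^+ m.+1) <-> le 1 c.
Proof.
case: (order_le) => refl anti trans total mull mulr c1.
split; last exact: le1_expg.
move=> Hm; case: (total 1 c) => // Hc; case: c1; apply: anti => //.
apply: trans Hm _; rewrite expgS -{3}(mulg1 c).
exact/mull/expg_le1.
Qed.

Lemma sign_expgV c m : c <> 1 -> le 1 (c ^+ m.+1)^-1 <-> ~ le 1 c.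
Proof.
case: (order_le) => refl anti trans total mull mulr c1; split=> [H Hc|H].
  case: c1; apply: anti => //.
  apply: (trans _ (c ^+ m.+1)).
    by rewrite expgS -{1}(mulg1 c); apply/mull/le1_expg.
  by have := mull (c ^+ m.+1) _ _ H; rewrite mulg1 mulgV.
case: (total 1 (c ^+ m.+1)) => [/(sign_expg _ c1)//|Hm].
by have := mull (c ^+ m.+1)^-1 _ _ Hm; rewrite mulg1 mulVg.
Qed.

End Signs.
End Words.

Section NoComputableOrder.
Local Notation G := (elt diag_slope).
Variables (le : G -> G -> Prop) (N : option nat) (x : nat -> G).
Hypothesis order_le : bi_order le.
Hypothesis gen_x : generating N x.
Hypothesis computable_le : computable_order_wrt N x le.

(** Over any generating family there are fixed words for t and x, out of which
    the words for the z_m are computable by prepending and iteration; the order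
    is then asked about the empty word and the word for z_m. *)
Lemma rec_sign :
  recursive 1 (fun v => nat_of_bool `[< le 1 (xcomm diag_slope (nth 0 v 0)) >]).
Proof.
have [wt Ht Et] := generating_word gen_x (gen diag_slope 0).
have [wx Hx Ex] := generating_word gen_x (gen diag_slope 1).
pose W m := wx ++ iter m (cat wt) (wx ++ iter m (cat (winv wt)) (winv wx ++
  iter m (cat wt) (winv wx ++ iter m (cat (winv wt)) [::]))).
have WN m : is_word N (W m).
  by rewrite /W; do ![apply: is_word_cat | apply: is_word_iter];
    rewrite ?is_word_winv.
have WE m : word_value x (W m) = xcomm diag_slope m.
  rewrite /W !(word_value_cat, word_value_iter) !word_value_winv Et Ex.
  rewrite [word_value x [::]]/word_value big_nil /xcomm /xconj !expg0.
  move: (gen _ 0) (gen _ 1) => a b.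
  by rewrite mul1g !mulg1 !expVgn !invgM invgK !mulgA.
have [c Hc] := computable_le.
have [cW HW] : recursive 1 (fun v => word_code (W (nth 0 v 0))).
  have W_code m : word_code (W m) = prepend wx (iter m (prepend wt) (prepend wx
      (iter m (prepend (winv wt)) (prepend (winv wx) (iter m (prepend wt)
      (prepend (winv wx) (iter m (prepend (winv wt)) 0))))))).
    by rewrite -[0]/(word_code [::]) !(prepend_iter, prependE).
  apply: rec_ext (fun v => esym (W_code (nth 0 v 0))) _.
  by do ![apply: rec_prepend | apply: rec_prepend_iter | exact: rec_nth];
    apply: rec_const.
exists (MuComp c [:: MuZero; cW]) => v sv; apply/computes_Comp.
exists [:: 0; word_code (W (nth 0 v 0))].
  by split=> // -[|[|i]] // _; apply: HW.
have [H1 H0] := Hc [::] (W (nth 0 v 0)).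
have {}H1 : le 1 (xcomm diag_slope (nth 0 v 0)) ->
    computes c [:: 0; word_code (W (nth 0 v 0))] 1.
  by move=> H; apply: H1; rewrite WE /word_value big_nil.
case: asboolP => [/H1//|nle]; apply: H0 => -[_ _].
by rewrite WE /word_value big_nil.
Qed.

Lemma no_computable_order : False.
Proof.
pose sgn m : bool := `[< le 1 (xcomm diag_slope m) >].
have rec_sgn k F : recursive k F ->
    recursive k (fun v => nat_of_bool (sgn (F v))).
  exact: (rec_app1 (f := fun m => nat_of_bool (sgn m))) rec_sign.
have [c Hc] : recursive 1 (fun v => nat_of_bool
    ((sgn (nth 0 v 0).*2.+1 : nat) == (sgn (nth 0 v 0).*2.+2 : nat))).
  by rec_tac; apply: rec_sgn; rec_tac.
pose n := mucode_code c.
have Hn : computes c [:: n] ((sgn n.*2.+1 : nat) == (sgn n.*2.+2 : nat)).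
  exact: (Hc [:: n]).
have Hs b s : certifies n s b -> b = ((sgn n.*2.+1 : nat) == (sgn n.*2.+2 : nat)).
  exact: certifies_sound Hn.
have [s Hfs] : exists s, first_halt n s.
  have [s cs] := certifies_complete Hn.
  have hs : exists s, halts n s.
    exists s; rewrite /halts; move: cs.
    by case: (_ == _) => /= ->; rewrite ?orbT.
  exists (ex_minn hs); case: ex_minnP => r hr r_min.
  rewrite /first_halt hr; apply/bforallP => i ir; apply/negP => /r_min.
  by rewrite leqNgt ir.
have c1 := @ccomm_neq1 diag_slope n.
have sgnE m : sgn m <-> le 1 (xcomm diag_slope m) by split=> /asboolP.
have /andP[Hh _] := Hfs.
case C0: (certifies n s 0).
  (* The program answers that the signs differ, whereas a_n = (s + 1) c_n. *)
  have Ea : acomm diag_slope n = ccomm diag_slope n ^+ s.+1.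
    by apply/acomm_pos/diag_posE; rewrite /diag_pos Hfs.
  have := Hs _ _ C0; rewrite (_ : sgn n.*2.+1 = sgn n.*2.+2) ?eqxx //.
  have Hiff := sign_expg order_le s c1; rewrite -Ea in Hiff.
  by apply/idP/idP => /sgnE/Hiff/sgnE.
(* The program answers that the signs agree, whereas a_n = - (s + 1) c_n. *)
have Ea : acomm diag_slope n = (ccomm diag_slope n ^+ s.+1)^-1.
  by apply/acomm_neg/diag_negE; rewrite /diag_neg Hfs C0.
move: Hh; rewrite /halts C0 /= => /Hs.
rewrite (_ : sgn n.*2.+1 = ~~ sgn n.*2.+2); first by case: (sgn _).
have Hiff := sign_expgV order_le s c1; rewrite -Ea in Hiff.
apply/idP/idP => [/sgnE/Hiff H|/negP H]; first by apply/negP => /sgnE.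
by apply/sgnE/Hiff => /sgnE.
Qed.

End NoComputableOrder.

Theorem corollary1 :
  exists G : groupType,
    computable_group G /\
    bi_orderable G /\
    (forall le : G -> G -> Prop, bi_order le ->
       forall (N : option nat) (x : nat -> G), generating N x ->
         ~ computable_order_wrt N x le) /\
    two_generated G /\
    solvable_of_derived_length G 3.
Proof.
exists (elt diag_slope); split; [|split; [|split; [|split]]].
- exact: elt_computable diag_posE diag_negE diag_slope_cases
    rec_diag_pos rec_diag_neg.
- exact: elt_bi_orderable.
- by move=> le order_le N x gen_x; apply: no_computable_order.
- exact: elt_two_generated.
- exact: elt_derived_length.
Qed.
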